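(* Let $V=X\oplus Y$ be a complex symplectic vector space of dimension $2n>0$ with $X,Y$ complementary Lagrangian subspaces, and let $G<\mathrm{GL}(X)<\mathrm{Sp}(V)$ be a finite subgroup. If $g_1,\ldots,g_n\in\mathcal{O}_Y^G$ are homogeneous of positive degree and form a regular sequence, then $$\mathrm{topdeg}(\mathsf{HP}_0(\mathcal{O}_V^G,\mathcal{O}_V))\le2\sum_{i=1}^n(|g_i|-2),$$ where $|g_i|$ denotes the degree of $g_i$.
   Context: $\mathrm{GL}(X)<\mathrm{Sp}(V)$ via $A\mapsto A\oplus(A^{-1})^*$, using $Y\cong X^*$ via the symplectic form; $G$ thus acts on $Y$ and on the algebra $\mathcal{O}_Y$ of polynomial functions on $Y$. $\mathcal{O}_V$ is the algebra of polynomial functions on $V$ with the Poisson bracket induced by the symplectic form, graded by polynomial degree. $\mathsf{HP}_0(\mathcal{O}_V^G,\mathcal{O}_V):=\mathcal{O}_V/\{\mathcal{O}_V^G,\mathcal{O}_V\}$ (quotient by the linear span of brackets), with the induced grading. $\mathrm{topdeg}(K)$ is the largest degree in which the graded space $K$ is nonzero ($-\infty$ if $K=0$). *)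

(* Defs.v *)
From HB Require Import structures.
From mathcomp Require Import all_boot all_order all_algebra.
From mathcomp Require Import sesquilinear generic_quotient ring_quotient.
(* mpoly has to be imported before ereal: the other order makes the level of
   the postfix notations of mpoly clash with the one of [\bar]. *)
From mathcomp Require Import mpoly complex.
From mathcomp Require Import boolp classical_sets reals constructive_ereal ereal.

Set Implicit Arguments.
Unset Strict Implicit.
Unset Printing Implicit Defensive.

Import Order.TTheory GRing.Theory Num.Theory.
Local Open Scope classical_set_scope.
Local Open Scope ring_scope.
Local Open Scope quotient_scope.

Definition in_ideal (A : comNzRingType) (n : nat) (g : 'I_n -> A)
    (P : pred 'I_n) (x : A) : Prop :=
  exists c : 'I_n -> A, x = \sum_(j < n | P j) c j * g j.

Definition regular_sequence (A : comNzRingType) (n : nat) (g : 'I_n -> A) :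
    Prop :=
  (forall (i : 'I_n) (a : A),
     in_ideal g (fun j => (j < i)%N) (a * g i) ->
     in_ideal g (fun j => (j < i)%N) a)
  /\ ~ in_ideal g predT 1.

Section LinearSpan.
Variables (K : nzRingType) (E : lmodType K) (S : set E).

Definition lspan : {pred E} := [pred x | `[< exists2 s : seq (K * E),
  (forall p, p \in s -> S p.2) & x = \sum_(p <- s) p.1 *: p.2 >]].

Lemma lspan_zmod_closed : zmod_closed lspan.
Proof.
split=> [|x y /asboolP[s sS ->] /asboolP[t tS ->]]; apply/asboolP.
  by exists [::]; rewrite ?big_nil.
exists (s ++ [seq (- p.1, p.2) | p <- t]) => [p|].
  by rewrite mem_cat => /orP[/sS//|/mapP[q /tS ? ->]].
rewrite big_cat big_map /= -sumrN; congr (_ + _).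
by apply: eq_bigr => p _; rewrite scaleNr.
Qed.

HB.instance Definition _ := GRing.isZmodClosed.Build E lspan lspan_zmod_closed.

End LinearSpan.

(* The largest degree of a nonzero component, as a supremum in [\bar R]: it is
   -oo for K = 0, and +oo when nonzero components occur in arbitrarily large
   degrees. *)
Definition topdeg (R : realType) (K : zmodType) (comp : nat -> set K) : \bar R :=
  ereal_sup [set k%:R%:E | k in [set k | exists2 x, comp k x & x <> 0]].

Section PolynomialFunctions.
Variables (C : fieldType) (U : vectType C).

(* Polynomial functions on U, written in the coordinates of the basis
   [vbasis {:U}]: the variable 'X_i is the i-th coordinate function. *)
Definition polyfun := {mpoly C[\dim {:U}]}.

HB.instance Definition _ := GRing.ComNzRing.on polyfun.
HB.instance Definition _ := GRing.Lmodule.on polyfun.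

Definition pf_eval (f : polyfun) (u : U) : C :=
  f.@[fun i => coord (vbasis {:U}) i u].

Definition pf_invariant (I : eqType) (G : seq I) (act : I -> U -> U)
    (f : polyfun) : Prop :=
  forall g, g \in G -> forall u, pf_eval f (act g u) = pf_eval f u.

End PolynomialFunctions.

Section Symplectic.
Variables (C : fieldType) (V : vectType C) (w : {skew_symmetric V}).

Definition lagrangian (L : {vspace V}) : Prop := orthov w L = L.

Definition gram : 'M[C]_(\dim {:V}) :=
  \matrix_(i, j) w (vbasis {:V})`_i (vbasis {:V})`_j.

(* The form on V^* transported from w along V ~ V^*, a |-> w a _, has matrix
   (gram^-1)^T in the dual basis, so that {w a _, w b _} = w a b. *)
Definition poisson (f h : polyfun V) : polyfun V :=
  \sum_(i < \dim {:V}) \sum_(j < \dim {:V})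
    (invmx gram)^T i j *: (mderiv i f * mderiv j h).

Variables X Y : {vspace V}.

Definition finite_subgroup_GL (G : seq 'End(subvs_of X)) : Prop :=
  [/\ \1%VF \in G,
      forall A, A \in G -> lker A = 0%VS,
      forall A, A \in G -> (A^-1)%VF \in G
    & forall A B, A \in G -> B \in G -> (A \o B)%VF \in G].

(* The map Y -> X^*, y |-> w _ y (an isomorphism when X and Y are complementary
   Lagrangian subspaces). *)
Definition dualY : 'Hom(subvs_of Y, 'Hom(subvs_of X, C^o)) :=
  linfun (fun y => linfun (fun x => w (vsval x) (vsval y) : C^o)).

Definition GL_actY (A : 'End(subvs_of X)) (y : subvs_of Y) : subvs_of Y :=
  (dualY^-1)%VF (dualY y \o A^-1)%VF.

Definition GL_actV (A : 'End(subvs_of X)) (v : V) : V :=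
  vsval (A (vsproj X (daddv_pi X Y v)))
  + vsval (GL_actY A (vsproj Y (daddv_pi Y X v))).

Variable G : seq 'End(subvs_of X).

Definition OV_inv : set (polyfun V) := [set f | pf_invariant G GL_actV f].

Definition OY_inv : set (polyfun (subvs_of Y)) :=
  [set f | pf_invariant G GL_actY f].

Definition brackets : set (polyfun V) :=
  [set b | exists f h, OV_inv f /\ b = poisson f h].

Definition HP0 := Quotient.quot (lspan brackets).

HB.instance Definition _ := GRing.Zmodule.on HP0.

Definition HP0_comp (k : nat) : set HP0 :=
  [set \pi_HP0 f | f in [set f : polyfun V | f \is k.-homog]].

End Symplectic.

Arguments topdeg R {K} comp.
Arguments HP0_comp {C V} w {X} Y G k _.

(* Main.v *)
Require Import Defs.
From HB Require Import structures.
From mathcomp Require Import all_boot all_order all_algebra.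
From mathcomp Require Import sesquilinear generic_quotient ring_quotient.
From mathcomp Require Import mpoly complex.
From mathcomp Require Import boolp classical_sets reals constructive_ereal ereal.
From mathcomp Require Import ring zify.

(* Idea.  Write x, y for coordinates on X and Y, and S = sum (d_i - 2).  For a
   function g of y, the operator {g, -} is sum_j (dg/dy_j) d/dx_j, up to sign.
   It suffices that the images of the operators {g_i, -} contain every
   polynomial of y-degree > S: averaging a hermitian form over G identifies X
   with the complex conjugate of Y, G-equivariantly, so that the polynomials
   conjugate to the g_i are invariants on X satisfying the same hypotheses, and
   a monomial of total degree > 2 S has degree > S in x or in y.

   Replacing d/dx_j by indeterminates xi_j turns {g_i, -} into the derivative
   s_i of g_i in the generic direction xi, a form of degree d_i - 1 in y over
   K = k(xi).  If s_1, ..., s_n is a regular sequence in K[y], its Hilbert series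
   shows that it generates all forms f in y of degree > S; hence q(xi) f lies in
   (s_1, ..., s_n) over k[xi] for some q <> 0, and q(d/dx) is onto since it has
   constant coefficients.

   To see that the s_i form a regular sequence, trade g_i for s_i one at a time.
   This works as long as g_i is nilpotent modulo s_1, ..., s_i, g_(i+1), ..., g_n.
   Otherwise these equations have a solution z with g_i(z) = 1 in some field
   containing K.  The derivations d/dxi_l extend to that field, and applying them
   to the equations contradicts the rank of the Jacobian matrix of g at z, because
   the z_j are algebraic over the g_i(z). *)

Set Implicit Arguments.
Unset Strict Implicit.
Unset Printing Implicit Defensive.

Import Order.TTheory GRing.Theory Num.Theory.
Local Open Scope ring_scope.
Local Open Scope quotient_scope.

(** * Ideals and regular sequences of homogeneous polynomials *)

Section Ideals.
Variable A : comNzRingType.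
Implicit Types (l : seq A) (x y c f : A).

(** Membership in the ideal generated by [l], with one coefficient peeled off per generator, so that
    proofs go by induction on [l] without families of coefficients. *)
Fixpoint idl l x : Prop :=
  if l is f :: l' then exists c, idl l' (x - c * f) else x = 0.

(** Multiplication by [f] is injective modulo the ideal of [l], which may be the whole ring. *)
Definition nzd l f : Prop := forall a, idl l (a * f) -> idl l a.

(* The sequence is listed backwards: its last element is the head. *)
Fixpoint reg l : Prop := if l is f :: l' then reg l' /\ nzd l' f else True.

Lemma idl0 l : idl l 0.
Proof. by elim: l => //= f l IH; exists 0; rewrite mul0r subr0. Qed.

Lemma idlD l x y : idl l x -> idl l y -> idl l (x + y).
Proof.
elim: l x y => [|f l IH] x y /=; first by move=> -> ->; rewrite addr0.
move=> [c xc] [e ye]; exists (c + e).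
by have := IH _ _ xc ye; congr idl; ring.
Qed.

Lemma idlM l c x : idl l x -> idl l (c * x).
Proof.
elim: l x => [|f l IH] x /=; first by move=> ->; rewrite mulr0.
by move=> [e xe]; exists (c * e); have := IH _ xe; congr idl; ring.
Qed.

Lemma idlMr l c x : idl l x -> idl l (x * c).
Proof. by rewrite mulrC; apply: idlM. Qed.

Lemma idlN l x : idl l x -> idl l (- x).
Proof. by move=> /(idlM (-1)); rewrite mulN1r. Qed.

Lemma idl_sum l (I : Type) (r : seq I) (P : pred I) (F : I -> A) :
  (forall i, P i -> idl l (F i)) -> idl l (\sum_(i <- r | P i) F i).
Proof. by move=> lF; elim/big_ind: _ => //; [apply: idl0|apply: idlD]. Qed.

Lemma idlS f l x : idl l x -> idl (f :: l) x.
Proof. by move=> lx; exists 0; rewrite mul0r subr0. Qed.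

Lemma idl_mem l f : f \in l -> idl l f.
Proof.
elim: l => // g l IH; rewrite inE => /orP[/eqP->|/IH]; last exact: idlS.
by exists 1; rewrite mul1r subrr; apply: idl0.
Qed.

Lemma idl_sub l l' x : (forall f, f \in l -> idl l' f) -> idl l x -> idl l' x.
Proof.
elim: l x => [|f l IH] x ll' /=; first by move=> ->; apply: idl0.
move=> [c xc]; rewrite -(subrK (c * f) x); apply: idlD.
  by apply: IH xc => g gl; apply: ll'; rewrite inE gl orbT.
by apply: idlM; apply: ll'; rewrite mem_head.
Qed.

Lemma idl_mem_sub l l' x : {subset l <= l'} -> idl l x -> idl l' x.
Proof. by move=> ll'; apply: idl_sub => f /ll'; apply: idl_mem. Qed.

Lemma eq_mem_idl l l' x : l =i l' -> idl l x <-> idl l' x.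
Proof. by move=> ll'; split; apply: idl_mem_sub => f; rewrite ll'. Qed.

Lemma eq_mem_nzd l l' f : l =i l' -> nzd l f -> nzd l' f.
Proof.
move=> ll' nf a /(eq_mem_idl _ ll')/nf; exact: (proj1 (eq_mem_idl _ ll')).
Qed.

(** Modulo [l], [x ^+ M] is a multiple of [f]. So [a * f = 0] gives [a * x ^+ M = 0], and the
    nonzerodivisor [x] is cancelled [M] times. *)
Lemma reg_exchange l x f M :
  reg (x :: l) -> idl (f :: l) (x ^+ M) -> reg (f :: l).
Proof.
move=> [rl nx] [c xc]; split=> // a af.
have : idl l (a * x ^+ M).
  rewrite -(subrK (c * f) (x ^+ M)) mulrDr; apply: idlD; first exact: idlM.
  by rewrite mulrCA; apply: idlM.
by elim: (M) => [|k IH]; rewrite ?expr0 ?mulr1 // exprSr mulrA => /nx/IH.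
Qed.

End Ideals.

Lemma idl_map (A B : comNzRingType) (h : {rmorphism A -> B}) l x :
  idl l x -> idl (map h l) (h x).
Proof.
elim: l x => [|f l IH] x /=; first by move=> ->; rewrite rmorph0.
by move=> [c /IH]; rewrite rmorphB rmorphM; exists (h c).
Qed.

Section Homogeneous.
Variables (n : nat) (R : comNzRingType).
Implicit Types (l : seq {mpoly R[n]}) (p q f a : {mpoly R[n]}).

Lemma pihomogMr e f d p : f \is e.-homog ->
  pihomog mdeg d (p * f) = if (e <= d)%N then pihomog mdeg (d - e) p * f else 0.
Proof.
(* The bound [k] covers all components of [p] and also exceeds [d], so that [d - e] is an index of
   the partition. *)
move=> fe; pose k := maxn (msize p) d.+1.
have psz : (msize p <= k)%N by rewrite leq_maxl.
rewrite {1}(pihomog_partitionE psz) mulr_suml raddf_sum /=.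
have term (i : 'I_k) : pihomog mdeg i p * f \is (i + e).-homog.
  by apply: dhomogM => //; apply: pihomogP.
case: ifP => [ed|/negbT ed].
  have dk : (d - e < k)%N.
    by apply: leq_ltn_trans (leq_subr _ _) _; rewrite leq_max ltnSn orbT.
  rewrite (bigD1 (Ordinal dk)) //= big1 ?addr0; last first.
    move=> i neq; apply: (pihomog_ne0 _ (term i)).
    by apply: contra neq => /eqP h; rewrite -val_eqE /= -h addnK.
  by apply: pihomog_dE; rewrite -[X in X.-homog](subnK ed); apply: (term (Ordinal dk)).
rewrite big1 // => i _; apply: (pihomog_ne0 _ (term i)).
by apply: contraNneq ed => <-; rewrite leq_addl.
Qed.

Definition homogs l : Prop := forall f, f \in l -> exists d, f \is d.-homog.

Lemma homogs_cons f l : homogs (f :: l) -> homogs l.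
Proof. by move=> h g gl; apply: h; rewrite inE gl orbT. Qed.

Lemma idl_pihomog l d p : homogs l -> idl l p -> idl l (pihomog mdeg d p).
Proof.
elim: l p => [|f l IH] p hl /=; first by move=> ->; rewrite raddf0.
move=> [c pc]; have [e fe] := hl _ (mem_head _ _).
have := IH _ (homogs_cons hl) pc; rewrite raddfB /= (pihomogMr _ _ fe).
by case: ifP => _ h; [exists (pihomog mdeg (d - e) c)|exists 0; rewrite mul0r].
Qed.

Lemma idl_homog l p : (forall d, idl l (pihomog mdeg d p)) -> idl l p.
Proof.
by move=> h; rewrite (pihomog_partitionE (leqnn (msize p))); apply: idl_sum.
Qed.

(* Graded Nakayama, by induction on the degree of the multiplier. *)
Lemma nzd_swap l f g df dg : homogs l -> f \is df.-homog -> g \is dg.-homog ->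
  (0 < dg)%N -> nzd l g -> nzd (g :: l) f -> nzd l f.
Proof.
move=> hl fd gd dg0 ng nf a af.
have red d b : b \is d.-homog -> idl l (b * f) -> idl l b.
  have [k] := ubnP d; elim: k d b => // k IH d b dk bd bf.
  have [c bc] := nf _ (idlS g bf).
  have := idl_pihomog d hl bc; rewrite raddfB /= pihomog_dE // (pihomogMr _ _ gd).
  case: ifP => [dgd|_]; last by rewrite subr0.
  set c' := pihomog _ _ _ => bc'.
  (* The product [c' * g * f] lies in the ideal, hence so does [c' * f]; and [c'] has lower degree
     than [b] because [dg] is positive. *)
  have c'l : idl l c'.
    apply: (IH (d - dg)%N); [|exact: pihomogP|].
      by move: dk; rewrite ltnS; apply: leq_trans; rewrite ltn_subrL dg0 (leq_trans dg0 dgd).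
    apply: ng; rewrite mulrAC -[c' * g](subrK b) mulrDl; apply: idlD => //.
    by apply: idlMr; rewrite -opprB; apply: idlN.
  by rewrite -(subrK (c' * g) b); apply: idlD => //; apply: idlMr.
apply: idl_homog => d; apply: (red d); first exact: pihomogP.
by have := idl_pihomog (d + df) hl af; rewrite (pihomogMr _ _ fd) leq_addl addnK.
Qed.

(** If [b * g = c * f] modulo [l], then [c = e * g] modulo [l], since [f] is a nonzerodivisor modulo
    [g] and [l]. Hence [(b - e * f) * g] lies in the ideal of [l], and [b = e * f] modulo [l]. *)
Lemma reg_swap l f g df dg : homogs l -> f \is df.-homog -> g \is dg.-homog ->
  (0 < dg)%N -> reg [:: f, g & l] -> reg [:: g, f & l].
Proof.
move=> hl fd gd dg0 [[rl ng] nf].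
have nf' := nzd_swap hl fd gd dg0 ng nf.
split=> [//|b].
move=> [c bgc].
have /nf[e ec] : idl (g :: l) (c * f).
  by exists b; rewrite -opprB; apply: idlN.
exists e; apply: ng.
have : idl l ((b * g - c * f) + (c - e * g) * f) by apply: idlD => //; apply: idlMr.
by congr idl; ring.
Qed.

Definition phomogs l : Prop :=
  forall f, f \in l -> exists2 d, (0 < d)%N & f \is d.-homog.

Lemma phomogsW l : phomogs l -> homogs l.
Proof. by move=> h f /h[d _ fd]; exists d. Qed.

(** Repeated swaps bring [f] to the head: regularity of forms of positive degree does not depend on
    their order. *)
Lemma reg_rot l1 l2 f : phomogs (f :: l1 ++ l2) ->
  reg (l1 ++ f :: l2) <-> reg (f :: l1 ++ l2).
Proof.
elim: l1 => [|g l1 IH] // hl.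
have hl' : phomogs (f :: l1 ++ l2).
  by move=> h hin; apply: hl; move: hin; rewrite !inE => /orP[->|->]; rewrite ?orbT.
have [df df0 fd] := hl f (mem_head _ _).
have [dg dg0 gd] : exists2 d, (0 < d)%N & g \is d.-homog.
  by apply: hl; rewrite !inE eqxx orbT.
have hll : homogs (l1 ++ l2).
  by apply: phomogsW => h hin; apply: hl'; rewrite inE hin orbT.
have eqm : l1 ++ f :: l2 =i f :: l1 ++ l2.
  by move=> h; rewrite !(inE, mem_cat) orbCA.
split=> [[/(IH hl') r ng]|r].
  apply: (reg_swap hll gd fd df0); split=> //.
  exact: eq_mem_nzd ng.
have [r1 ng] := reg_swap hll fd gd dg0 r.
split; first exact/(IH hl').
by apply: eq_mem_nzd ng => h; rewrite eqm.
Qed.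

(* If 1 = c (f - 1) + r with r in the ideal, then comparing the components of
   degree k e gives [c_(k e) = - f ^ k] modulo the ideal, and c has finitely
   many components. *)
Lemma idl_dehomog l f e : homogs l -> (0 < e)%N -> f \is e.-homog ->
  idl (f - 1 :: l) 1 -> exists M, idl l (f ^+ M).
Proof.
move=> hl e0 fe [c cl].
have comp d : idl l (pihomog mdeg d 1
    - ((if (e <= d)%N then pihomog mdeg (d - e) c * f else 0) - pihomog mdeg d c)).
  have := idl_pihomog d hl cl.
  by rewrite mulrBr mulr1 !raddfB /= (pihomogMr _ _ fe).
have pow k : idl l (pihomog mdeg (k * e) c + f ^+ k).
  elim: k => [|k IH].
    have := comp 0%N; rewrite mul0n expr0 leqNgt e0 /= pihomog_dE ?dhomog1 //.
    by rewrite sub0r opprK addrC.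
  have := comp (k.+1 * e)%N.
  rewrite mulSn leq_addr addKn (@pihomog_ne0 _ _ mdeg 0%N) ?dhomog1 //; last first.
    by rewrite eq_sym addn_eq0 (gtn_eqF e0).
  move=> h; have := idlD h (idlMr f IH); congr idl.
  by rewrite exprSr; ring.
exists (msize c); have := pow (msize c).
suff -> : pihomog mdeg (msize c * e) c = 0 by rewrite add0r.
apply/mpolyP => m; rewrite mcoeff0.
have [mde|mde] := eqVneq (mdeg m) (msize c * e)%N; last first.
  exact: dhomog_nemf_coeff (pihomogP _ _ _) mde.
rewrite (@pihomogwE _ _ _ _ (msize c)) // raddf_sum /=.
rewrite big1 // => b /eqP bd; rewrite mcoeffZ mcoeffX.
case: eqP => [bm|]; last by rewrite mulr0.
by have := bmdeg b; rewrite bd ltnNge leq_pmulr.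
Qed.

End Homogeneous.

(** * Hilbert series *)

Section TruncatedSeries.
Variable M : nat.
Implicit Types P Q : {poly int}.

(** Congruence modulo ['X^M], which lets integer polynomials stand for power series. *)
Definition eqXn P Q : Prop := exists T, P = Q + T * 'X^M.

Lemma eqXn_coef P Q : (forall m, (m < M)%N -> P`_m = Q`_m) <-> eqXn P Q.
Proof.
split=> [h|[T ->] m mM]; last by rewrite coefD coefMXn mM addr0.
exists (drop_poly M (P - Q)).
have tk0 : take_poly M (P - Q) = 0.
  apply/polyP => i; rewrite coef_take_poly coef0.
  by case: ifP => // iM; rewrite coefB h // subrr.
by have := poly_take_drop M (P - Q); rewrite tk0 add0r => ->; rewrite addrC subrK.
Qed.

Lemma eqXn_trans P Q T : eqXn P Q -> eqXn Q T -> eqXn P T.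
Proof. by move=> [A ->] [B ->]; exists (A + B); ring. Qed.

Lemma eqXn_mul U P Q : eqXn P Q -> eqXn (U * P) (U * Q).
Proof. by move=> [A ->]; exists (U * A); ring. Qed.

(** The binomial coefficients are the coefficients of the inverse of [(1 - 'X) ^+ n.+1], the Hilbert
    series of a polynomial ring in [n.+1] variables. The induction is Pascal's rule. *)
Lemma eqXn_binomial n :
  eqXn ((1 - 'X) ^+ n.+1 * \poly_(m < M) ('C(m + n, m))%:R) 1.
Proof.
elim: n => [|n IH].
  apply/eqXn_coef => m mM; rewrite expr1 mulrBl mul1r coefB coefXM coef1.
  rewrite !coef_poly mM addn0 binn.
  by case: m mM => [|m] mM //=; rewrite (ltn_trans (ltnSn m) mM) addn0 binn.
rewrite exprS -mulrA mulrCA; apply: eqXn_trans IH; apply: eqXn_mul.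
apply/eqXn_coef => m mM; rewrite mulrBl mul1r coefB coefXM !coef_poly mM.
case: m mM => [|m] mM /=; first by rewrite !bin0 subr0.
by rewrite (ltn_trans (ltnSn m) mM) addSn binS natrD addrK addSnnS.
Qed.

End TruncatedSeries.

(** The product has degree equal to the sum of the [i - 1], or vanishes when some [i] is 0. *)
Lemma coef_prod_geometric (e : seq nat) m :
  (\sum_(i <- e) i < m + size e)%N ->
  (\prod_(i <- e) \sum_(k < i) ('X^k : {poly int}))`_m = 0.
Proof.
elim: e m => [|i e IH] m; first by rewrite !big_nil coef1; case: m.
rewrite !big_cons => lt_m; rewrite coefM big1 // => j _.
have [ji|ij] := ltnP j i.
  rewrite IH ?mulr0 //; have := ltn_ord j; move: lt_m ji => /=; lia.
rewrite coef_sum big1 ?mul0r // => k _.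
by rewrite coefXn gtn_eqF // (leq_trans (ltn_ord k)).
Qed.

Section Hilbert.
Variables (n : nat) (F : fieldType).
Local Notation D d := (dhomog n.+1 F d).
Implicit Types (f p : {mpoly F[n.+1]}) (l : seq ({mpoly F[n.+1]} * nat)).

(** Projecting onto degree [m] gives a linear map between components for all [d] and [m]; it is
    multiplication by [f] when the degrees add up. *)
Definition mulh f d m (p : D d) : D m := DHomog (pihomogP mdeg m (val p * f)).

Fact mulh_is_linear f d m : linear (@mulh f d m).
Proof.
by move=> a p q; apply: val_inj; rewrite /= mulrDl -scalerAl linearP.
Qed.
HB.instance Definition _ f d m :=
  GRing.isLinear.Build F (D d) (D m) _ (@mulh f d m) (@mulh_is_linear f d m).

(** The degree [m] component of the ideal, as a subspace with a dimension. The test [e <= m] guards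
    against truncated subtraction. *)
Fixpoint idl_comp l m : {vspace D m} :=
  if l is (f, e) :: l' then
    (idl_comp l' m + if (e <= m)%N then limg (linfun (@mulh f (m - e) m)) else 0)%VS
  else 0%VS.

Definition degs l := forall fe, fe \in l -> fe.1 \is (fe.2).-homog.

Lemma degs_homogs l : degs l -> homogs (map fst l).
Proof. by move=> h _ /mapP[fe /h fd ->]; exists fe.2. Qed.

Lemma degs_cons fe l : degs (fe :: l) -> degs l.
Proof. by move=> h g gl; apply: h; rewrite inE gl orbT. Qed.

Lemma mem_idl_comp l m (u : D m) : degs l ->
  u \in idl_comp l m <-> idl (map fst l) (val u).
Proof.
elim: l m u => [|[f e] l IH] m u dl.
  by rewrite /= memv0; split=> [/eqP->|u0] //; apply/eqP/val_inj.
have fe : f \is e.-homog by apply: (dl (f, e)); rewrite mem_head.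
have dl' := degs_cons dl; have hl := degs_homogs dl'.
have um := valP u; rewrite /= in um.
split.
  move=> /memv_addP[u1 /(IH _ _ dl') u1l [u2 u2f ->]] /=.
  case: ifP u2f => [em /memv_imgP[p _ ->]|_]; last first.
    by rewrite memv0 => /eqP->; exists 0; rewrite /= addr0 mul0r subr0.
  exists (val p); rewrite lfunE /= pihomog_dE ?addrK //.
  by rewrite -[X in X.-homog](subnK em); apply: dhomogM => //; apply: (valP p).
move=> [c uc]; have := idl_pihomog m hl uc.
rewrite raddfB /= pihomog_dE // (pihomogMr _ _ fe).
case: ifP => em ul; last first.
  by rewrite addv0; apply/(IH _ _ dl'); rewrite subr0 in ul.
pose p : D (m - e) := DHomog (pihomogP mdeg (m - e) c).
have pe : mulh f m p = pihomog mdeg (m - e) c * f :> {mpoly _[_]}.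
  rewrite /= pihomog_dE //.
  by rewrite -[X in X.-homog](subnK em); apply: dhomogM => //; apply: pihomogP.
rewrite -(subrK (mulh f m p) u); apply: memv_add.
  by apply/(IH _ _ dl'); rewrite raddfB /=; rewrite /= in pe; rewrite pe.
by rewrite -[mulh _ _ _](lfunE (@mulh f (m - e) m)) memv_img ?memvf.
Qed.

(** As [f] is a nonzerodivisor modulo [l], the multiples of [f] lying in the ideal of [l] are the
    multiples by elements of that ideal. The kernel of multiplication by [f] lies in the ideal, so
    its dimension cancels from the two rank formulas. *)
Lemma dim_idl_comp f e l m : degs ((f, e) :: l) -> nzd (map fst l) f ->
  (e <= m)%N ->
  (\dim (idl_comp ((f, e) :: l) m) + \dim (idl_comp l (m - e))
    = \dim (idl_comp l m) + \dim {:D (m - e)})%N.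
Proof.
move=> dl nf em; have dl' := degs_cons dl; rewrite /= em.
have fe : f \is e.-homog by apply: (dl (f, e)); rewrite mem_head.
set phi := linfun _; set U := idl_comp l m; set V := idl_comp l (m - e).
have phiE (p : D (m - e)) : phi p = val p * f :> {mpoly _[_]}.
  rewrite lfunE /= pihomog_dE // -[X in X.-homog](subnK em).
  by apply: dhomogM => //; apply: (valP p).
have memphi (p : D (m - e)) : phi p \in U -> p \in V.
  by move=> /(mem_idl_comp _ dl'); rewrite /= phiE => /nf /(mem_idl_comp _ dl').
have capE : (U :&: limg phi)%VS = (phi @: V)%VS.
  apply/vspaceP => u; rewrite memv_cap; apply/andP/idP.
    by move=> [uU /memv_imgP[p _ up]]; rewrite up memv_img // memphi -?up.
  move=> /memv_imgP[p pV ->]; split; last by rewrite memv_img ?memvf.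
  by apply/(mem_idl_comp _ dl'); rewrite /= phiE; apply/idlMr/(mem_idl_comp _ dl').
have kerV : (lker phi <= V)%VS.
  by apply/subvP => p; rewrite memv_ker => /eqP p0; apply: memphi; rewrite p0 mem0v.
have := dimv_sum_cap U (limg phi); rewrite capE.
have := limg_ker_dim phi fullv; rewrite capfv.
have := limg_ker_dim phi V; rewrite (capv_idPr kerV) => <- <- dimD.
by rewrite addnCA dimD addnCA.
Qed.

Definition hilb l m : int := (\dim {:D m})%:Z - (\dim (idl_comp l m))%:Z.

Lemma hilb_cons f e l m : degs ((f, e) :: l) -> nzd (map fst l) f ->
  hilb ((f, e) :: l) m = hilb l m - (if (e <= m)%N then hilb l (m - e) else 0).
Proof.
move=> dl nf; rewrite /hilb; case: ifP => em; last first.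
  by rewrite /= em addv0 subr0.
have := dim_idl_comp dl nf em; lia.
Qed.

(** Each further generator of degree [e] multiplies the Hilbert series of the quotient by
    [1 - 'X ^+ e]. *)
Lemma hilb_series M l : degs l -> reg (map fst l) ->
  eqXn M (\poly_(m < M) hilb l m)
    (\prod_(fe <- l) (1 - 'X ^+ fe.2) * \poly_(m < M) hilb [::] m).
Proof.
elim: l => [|[f e] l IH] dl.
  by move=> _; rewrite big_nil mul1r; exists 0; rewrite mul0r addr0.
move=> [rl nf]; rewrite big_cons -mulrA.
apply: eqXn_trans (eqXn_mul _ (IH (degs_cons dl) rl)).
apply/eqXn_coef => m mM; rewrite coef_poly mM hilb_cons // mulrBl mul1r.
rewrite coefB coefXnM !coef_poly mM ltnNge; case: (leqP e m) => //= em.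
by rewrite (leq_ltn_trans (leq_subr _ _) mM).
Qed.

(** With as many generators as variables, the Hilbert series of the quotient is a product of
    polynomials [1 + 'X + ... + 'X^(e - 1)], so that the quotient vanishes in degrees above the sum
    of the [e - 1]. *)
Lemma reg_topdeg l m p : degs l -> reg (map fst l) -> size l = n.+1 ->
  (\sum_(fe <- l) fe.2 < m + n.+1)%N -> p \is m.-homog -> idl (map fst l) p.
Proof.
move=> dl rl szl lt_m pm.
have h0 : hilb l m = 0.
  have hC i : hilb [::] i = ('C(i + n, i))%:R.
    by rewrite /hilb dimv0 subr0 dimvf /dim /= natz.
  pose q (i : nat) : {poly int} := \sum_(k < i) 'X^k.
  have prodE : \prod_(fe <- l) (1 - 'X ^+ fe.2 : {poly int})
      = (\prod_(i <- map snd l) q i) * (1 - 'X) ^+ n.+1.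
    have -> : (1 - 'X) ^+ n.+1 = \prod_(fe <- l) (1 - 'X : {poly int}).
      by rewrite -[in LHS]szl big_const_seq count_predT iter_mulr_1.
    rewrite big_map -big_split /=; apply: eq_bigr => fe _.
    by rewrite mulrC -opprB subrX1 -mulNr opprB.
  have := hilb_series m.+1 dl rl; rewrite prodE -mulrA.
  have polyE : \poly_(i < m.+1) hilb [::] i = \poly_(i < m.+1) ('C(i + n, i))%:R.
    by apply/polyP => i; rewrite !coef_poly hC.
  rewrite polyE => /eqXn_trans/(_ (eqXn_mul _ (eqXn_binomial m.+1 n))).
  rewrite mulr1 => /eqXn_coef/(_ m (ltnSn m)); rewrite coef_poly ltnSn => ->.
  by apply: coef_prod_geometric; rewrite size_map szl big_map.
have full : idl_comp l m = fullv.
  apply/eqP; rewrite eqEdim subvf /=; move: h0; rewrite /hilb; lia.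
by apply/(mem_idl_comp (DHomog pm) dl); rewrite full memvf.
Qed.

End Hilbert.

(** * Fields from proper ideals *)

Section FieldOfInverses.
Variables (Q : comNzRingType) (inv_ex : forall x : Q, x != 0 -> exists y, y * x = 1).

(** The argument keeps the existence of inverses in the type, so that a field structure can be
    attached to this copy of [Q]. *)
Definition field_of of (forall x : Q, x != 0 -> exists y, y * x = 1) : Type := Q.
HB.instance Definition _ := GRing.ComNzRing.on (field_of inv_ex).

Definition field_of_inv (x : field_of inv_ex) : field_of inv_ex :=
  if pselect (exists y, y * x = 1) is left h then sval (cid h) else 0.

Fact field_of_mulV x : x != 0 -> field_of_inv x * x = 1.
Proof.
move=> x0; rewrite /field_of_inv; case: pselect => [h|[]]; last exact: inv_ex.
exact: (svalP (cid h)).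
Qed.

Fact field_of_inv0 : field_of_inv 0 = 0.
Proof.
rewrite /field_of_inv; case: pselect => [h|//]; exfalso.
by case: h => y /eqP; rewrite mulr0 eq_sym oner_eq0.
Qed.

HB.instance Definition _ :=
  GRing.ComNzRing_isField.Build (field_of inv_ex) field_of_mulV field_of_inv0.
End FieldOfInverses.

Section MaximalIdeal.
Variable A : comNzRingType.

Section Quotient.
Variables (J : set A) (J0 : J 0) (J1 : ~ J 1).
Hypothesis JB : forall x y, J x -> J y -> J (x - y).
Hypothesis JM : forall c x, J x -> J (c * x).
Hypothesis Jmax : forall x, ~ J x -> exists c, J (1 - c * x).

Definition max_pred : {pred A} := fun x => `[< J x >].

Fact max_pred_closed : idealr_closed max_pred.
Proof.
split; rewrite ?unfold_in; [exact/asboolP|exact/asboolP|].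
move=> a u v /asboolP Ju /asboolP Jv; apply/asboolP.
rewrite -[v]opprK; apply: JB; first exact: JM.
by rewrite -[- v]add0r; apply: JB.
Qed.
HB.instance Definition _ := isIdealr.Build A max_pred max_pred_closed.

Fact max_quot_inv (x : {ideal_quot max_pred}) : x != 0 -> exists y, y * x = 1.
Proof.
elim/quotW: x => x; rewrite -(rmorph0 (\pi_{ideal_quot max_pred})).
rewrite -Quotient.idealrBE subr0 => /asboolP/Jmax[c cx].
exists (\pi c); rewrite -rmorphM -(rmorph1 (\pi_{ideal_quot max_pred})).
by apply/esym/eqP; rewrite -Quotient.idealrBE; apply/asboolP.
Qed.

Lemma field_of_maximal : exists (L : fieldType) (phi : {rmorphism A -> L}),
  forall x, J x -> phi x = 0.
Proof.
exists (field_of max_quot_inv), (\pi_{ideal_quot max_pred} : {rmorphism _ -> _}).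
move=> x Jx; rewrite -(rmorph0 (\pi_{ideal_quot max_pred})).
by apply/eqP; rewrite -Quotient.idealrBE subr0; apply/asboolP.
Qed.
End Quotient.

(** Zorn's lemma is applied to the sets [J] no finite part of which generates 1 together with [l]. A
    maximal such [J] is a maximal ideal containing [l], and the field is the quotient by it. *)
Lemma field_of_proper_ideal (l : seq A) : ~ idl l 1 ->
  exists (L : fieldType) (phi : {rmorphism A -> L}), forall f, f \in l -> phi f = 0.
Proof.
move=> l1.
pose proper (J : set A) := forall s, (forall f, f \in s -> J f) -> ~ idl (s ++ l) 1.
have [J [pJ maxJ]] : exists J, proper J /\ forall B, (J `<` B)%classic -> ~ proper B.
  apply: Zorn_bigcup => F FP Ftot s sF.
  case: s sF => [//|f s] sF.
  (* A finite part of the union of a chain lies in a single member of the chain. *)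
  suff [J FJ sJ] : exists2 J, F J & forall g, g \in f :: s -> J g by exact: FP sJ.
  elim: s f sF => [|g s IH] f sF.
    by have [J FJ Jf] := sF f (mem_head _ _); exists J => // g; rewrite inE => /eqP->.
  have [J FJ sJ] := IH g (fun h hs => sF h (@mem_behead _ (f :: _) _ hs)).
  have [J' FJ' J'f] := sF f (mem_head _ _).
  case: (Ftot _ _ FJ FJ') => sub; [exists J' => //|exists J => //].
    by move=> h; rewrite inE => /orP[/eqP->//|/sJ/sub].
  by move=> h; rewrite inE => /orP[/eqP->|/sJ//]; apply: sub.
(* Otherwise [x] could be added to [J]: a relation that uses [x] can be rewritten with the elements
   of [s] in its place. *)
have gen x s : (forall f, f \in s -> J f) -> idl (s ++ l) x -> J x.
  move=> sJ sx; apply: contrapT => nJx.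
  apply: (maxJ (fun y => J y \/ y = x)).
    split; first by move=> y; left.
    by move=> /(_ x (or_intror erefl)).
  move=> s' s'J s'1.
  apply: (pJ ([seq y <- s' | `[< J y >]] ++ s)).
    by move=> f; rewrite mem_cat mem_filter => /orP[/andP[/asboolP]//|/sJ].
  apply: idl_sub s'1 => f; rewrite mem_cat => /orP[fs'|fl]; last first.
    by apply: idl_mem; rewrite !mem_cat fl !orbT.
  case: (s'J _ fs') => [Jf|->].
    by apply: idl_mem; rewrite !mem_cat mem_filter fs' (asboolT Jf).
  by apply: idl_mem_sub sx => y; rewrite !mem_cat => /orP[]->; rewrite ?orbT.
have JC x y : J x -> J y -> forall c e, J (c * x + e * y).
  move=> Jx Jy c e; apply: (gen _ [:: x; y]).
    by move=> f; rewrite !inE => /orP[]/eqP->.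
  apply: idlD; apply: idlM; apply: idl_mem; rewrite mem_cat !inE eqxx ?orbT //.
have J0 : J 0 by apply: (gen _ [::]) => //; apply: idl0.
have J1 : ~ J 1.
  move=> J1; apply: (pJ [:: 1]); first by move=> f; rewrite inE => /eqP->.
  by apply: idl_mem; rewrite mem_cat inE eqxx.
have JB x y : J x -> J y -> J (x - y).
  by move=> Jx Jy; have := JC _ _ Jx Jy 1 (-1); rewrite mul1r mulN1r.
have JM c x : J x -> J (c * x).
  by move=> Jx; have := JC _ _ Jx Jx c 0; rewrite mul0r addr0.
have Jmax x : ~ J x -> exists c, J (1 - c * x).
  move=> nJx; apply: contrapT => nc.
  apply: (maxJ (fun y => J y \/ y = x)).
    split; first by move=> y; left.
    by move=> /(_ x (or_intror erefl)).
  move=> s sJ s1; apply: nc.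
  have : idl (x :: [seq y <- s | `[< J y >]] ++ l) 1.
    apply: idl_mem_sub s1 => y; rewrite !(inE, mem_cat) mem_filter.
    case/orP => [ys|->]; last by rewrite !orbT.
    by case: (sJ _ ys) => [/asboolT->|->]; rewrite ?ys ?eqxx ?orbT.
  move=> [c cx]; exists c; apply: gen cx => f.
  by rewrite mem_filter => /andP[/asboolP].
have [L [phi phiJ]] := field_of_maximal J0 J1 JB JM Jmax.
exists L, phi => f fl; apply: phiJ; apply: (gen _ [::]) => //; exact: idl_mem.
Qed.

End MaximalIdeal.

(** * Extension of derivations *)

Section Derivations.
Variable L : fieldType.
Implicit Types (S : set L) (D : L -> L) (p q : {poly L}).

Definition subring_set S : Prop :=
  [/\ S 1, forall x y, S x -> S y -> S (x - y)
    & forall x y, S x -> S y -> S (x * y)].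

(** A derivation from [S] to [L]: a total function constrained on [S] only, whose values may lie
    outside [S]. Extending it therefore changes no types. *)
Definition derivation_on S D : Prop :=
  [/\ forall x y, S x -> S y -> D (x + y) = D x + D y
    & forall x y, S x -> S y -> D (x * y) = D x * y + x * D y].

Definition over S p : Prop := forall i, S p`_i.

Section Extension.
Variables (S : set L) (D : L -> L) (theta : L).
Hypotheses (subS : subring_set S) (derD : derivation_on S D).

Lemma subring_set0 : S 0.
Proof. by case: subS => S1 SB _; rewrite -(subrr 1); apply: SB. Qed.

Lemma subring_setN x : S x -> S (- x).
Proof. by case: subS => _ SB _ Sx; rewrite -sub0r; apply: SB => //; apply: subring_set0. Qed.

Lemma subring_setD x y : S x -> S y -> S (x + y).
Proof. by case: subS => _ SB _ Sx Sy; rewrite -[y]opprK; apply: SB => //; apply: subring_setN. Qed.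

Lemma subring_set_sum (I : Type) (r : seq I) (P : pred I) (F : I -> L) :
  (forall i, P i -> S (F i)) -> S (\sum_(i <- r | P i) F i).
Proof.
by move=> SF; elim/big_ind: _ => //; [apply: subring_set0|apply: subring_setD].
Qed.

Lemma derivation_on0 : D 0 = 0.
Proof.
case: derD => DD _; have := DD 0 0 subring_set0 subring_set0.
by rewrite addr0 => /eqP; rewrite -subr_eq0 opprD addrA subrr sub0r oppr_eq0 => /eqP.
Qed.

Lemma derivation_on_sum (I : Type) (r : seq I) (P : pred I) (F : I -> L) :
  (forall i, P i -> S (F i)) ->
  D (\sum_(i <- r | P i) F i) = \sum_(i <- r | P i) D (F i).
Proof.
case: derD => DD _ SF.
suff [] : S (\sum_(i <- r | P i) F i) /\
  D (\sum_(i <- r | P i) F i) = \sum_(i <- r | P i) D (F i) by [].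
elim/big_rec2: _ => [|i y1 y2 Pi [Sy <-]].
  by split; [apply: subring_set0|apply: derivation_on0].
by split; [apply: subring_setD => //; apply: SF|apply: DD => //; apply: SF].
Qed.

Lemma overD p q : over S p -> over S q -> over S (p + q).
Proof. by move=> Sp Sq i; rewrite coefD; apply: subring_setD. Qed.

Lemma overN p : over S p -> over S (- p).
Proof. by move=> Sp i; rewrite coefN; apply: subring_setN. Qed.

Lemma overM p q : over S p -> over S q -> over S (p * q).
Proof.
by case: subS => _ _ SM Sp Sq i; rewrite coefM; apply: subring_set_sum => j _; apply: SM.
Qed.

Lemma overC c : S c -> over S c%:P.
Proof. by move=> Sc i; rewrite coefC; case: ifP => // _; apply: subring_set0. Qed.

Lemma overX : over S 'X.
Proof.
by move=> i; rewrite coefX; case: (i == _); [case: subS|apply: subring_set0].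
Qed.

Lemma overXn n : over S 'X^n.
Proof. by elim: n => [|n IH]; [apply: overC; case: subS|rewrite exprS; apply: overM overX IH]. Qed.

Lemma over_deriv p : over S p -> over S p^`().
Proof.
move=> Sp i; rewrite coef_deriv; move: (p`_i.+1) (Sp i.+1) => c Sc.
elim: i.+1 => [|k IH]; first by rewrite mulr0n; apply: subring_set0.
by rewrite mulrS; apply: subring_setD.
Qed.

Let mapD p := map_poly D p.

Let coef_mapD p i : (mapD p)`_i = D p`_i.
Proof. by rewrite coef_map_id0 // derivation_on0. Qed.

Let mapDD p q : over S p -> over S q -> mapD (p + q) = mapD p + mapD q.
Proof.
case: derD => DD _ Sp Sq; apply/polyP => i.
by rewrite coefD !coef_mapD coefD; apply: DD.
Qed.

Let mapDM p q : over S p -> over S q -> mapD (p * q) = mapD p * q + p * mapD q.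
Proof.
case: derD => DD DM Sp Sq; apply/polyP => i; rewrite coefD !coefM coef_mapD coefM.
rewrite derivation_on_sum; last by move=> j _; case: subS => _ _; apply.
by rewrite -big_split; apply: eq_bigr => j _; rewrite /= DM ?coef_mapD.
Qed.

Section Weight.
Variable w : L.

(** The forced value of an extension of [D] at [q.[theta]] once [w] is chosen as the derivative of
    [theta]. *)
Definition lift_der q := (mapD q).[theta] + q^`().[theta] * w.

Lemma lift_derD p q : over S p -> over S q ->
  lift_der (p + q) = lift_der p + lift_der q.
Proof. by move=> Sp Sq; rewrite /lift_der mapDD // derivD !hornerD; ring. Qed.

Lemma lift_derM p q : over S p -> over S q ->
  lift_der (p * q) = lift_der p * q.[theta] + p.[theta] * lift_der q.
Proof.
by move=> Sp Sq; rewrite /lift_der mapDM // derivM !(hornerD, hornerM); ring.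
Qed.

Lemma lift_der0 : lift_der 0 = 0.
Proof.
have -> : lift_der 0 = (mapD 0).[theta] by rewrite /lift_der deriv0 horner0 mul0r addr0.
by rewrite (_ : mapD 0 = 0) ?horner0 //; apply/polyP => i; rewrite coef_mapD coef0 derivation_on0.
Qed.

Lemma lift_derN p : over S p -> lift_der (- p) = - lift_der p.
Proof.
move=> Sp; apply/eqP; rewrite -addr_eq0 -lift_derD //; last exact: overN.
by rewrite addNr lift_der0.
Qed.

Lemma lift_derC c : S c -> lift_der c%:P = D c.
Proof.
move=> Sc; rewrite /lift_der derivC horner0 mul0r addr0.
suff -> : mapD c%:P = (D c)%:P by rewrite hornerC.
apply/polyP => i; rewrite coef_mapD !coefC; case: ifP => // _.
exact: derivation_on0.
Qed.
End Weight.

(* A weight for which the lift vanishes on the polynomials killing theta: 0 if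
   theta is transcendental, and - p^D(theta) / p'(theta) for p of minimal degree
   otherwise. *)
Lemma lift_weight : [pchar L] =i pred0 ->
  exists w, forall q, over S q -> q.[theta] = 0 -> lift_der w q = 0.
Proof.
move=> char0.
pose kills p := [/\ over S p, p != 0 & p.[theta] = 0].
have [[p0 kp0]|nk] := pselect (exists p, kills p); last first.
  exists 0 => q Sq q0; have [->|qn0] := eqVneq q 0; first exact: lift_der0.
  by exfalso; apply: nk; exists q.
pose szp k := `[< exists2 p, kills p & size p = k >].
have exk : exists k, szp k by exists (size p0); apply/asboolP; exists p0.
have [k /asboolP[p [Sp pn0 pt] szpk] kmin] := ex_minnP exk; subst k.
have pmin q : over S q -> q.[theta] = 0 -> (size q < size p)%N -> q = 0.
  move=> Sq qt; apply: contraTeq => qn0; rewrite -leqNgt; apply: kmin.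
  by apply/asboolP; exists q.
have sz_gt1 : (1 < size p)%N.
  rewrite ltnNge; apply/negP => /size1_polyC pC.
  by move: pt pn0; rewrite pC hornerC => ->; rewrite eqxx.
(* In characteristic zero the derivative of [p] is nonzero of smaller size, so minimality keeps it
   from killing [theta]. *)
have dpt : p^`().[theta] != 0.
  apply/eqP => dp0; have := pmin _ (over_deriv Sp) dp0 (lt_size_deriv pn0).
  move/(congr1 (fun q : {poly L} => q`_(size p).-2)); rewrite coef_deriv coef0.
  have -> : (size p).-2.+1 = (size p).-1 by case: (size p) sz_gt1 => [|[]].
  move/eqP; rewrite -mulr_natr mulf_eq0 lead_coef_eq0 (negPf pn0) /=.
  by rewrite (proj1 (pcharf0P L) char0) => /eqP; case: (size p) sz_gt1 => [|[]].
pose w := - (mapD p).[theta] / p^`().[theta].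
have Ep : lift_der w p = 0 by rewrite /lift_der mulrCA divff // mulr1 subrr.
exists w => q; have [m] := ubnP (size q); elim: m q => // m IH q szq Sq qt.
have [/pmin-> //|sz_pq] := ltnP (size q) (size p); first exact: lift_der0.
(* One step of pseudo-division by [p]. The leading coefficient of [p] need not be invertible in [S],
   so [q] is multiplied by it; this factor is cancelled in [L] at the end. *)
pose u := (lead_coef q)%:P * 'X^(size q - size p).
have Su : over S u by apply: overM; [apply/overC/Sq|apply: overXn].
have SCp : over S (lead_coef p)%:P by apply: overC; apply: Sp.
pose r := (lead_coef p)%:P * q + - (u * p).
have Sr : over S r by apply: overD; [apply: overM|apply/overN/overM].
have qn0 : q != 0 by rewrite -size_poly_gt0 (leq_trans _ sz_pq) // ltnW.
have szr : (size r < size q)%N.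
  have szX : size ('X^(size q - size p) * p) = size q.
    by rewrite mulrC size_mulXn // subnK.
  rewrite -[size q]prednK ?size_poly_gt0 // ltnS; apply/leq_sizeP => j.
  rewrite leq_eqVlt => /predU1P[<-|jq].
    rewrite coefD coefN /u -mulrA !coefCM.
    rewrite mulrC -lead_coefE [X in - X]mulrC coefXnM.
    rewrite ifN; last by rewrite -leqNgt -subn1 leq_sub2l // ltnW.
    suff -> : ((size q).-1 - (size q - size p))%N = (size p).-1.
      by rewrite -lead_coefE mulrC subrr.
    rewrite -subn1 subnAC subKn // subn1 //.
  have {}jq : (size q <= j)%N by rewrite -[size q]prednK ?size_poly_gt0.
  rewrite coefD coefN /u -mulrA !coefCM [q`_j]nth_default // mulr0 sub0r.
  by rewrite nth_default ?mulr0 ?oppr0 // szX.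
have rt : r.[theta] = 0.
  by rewrite /r !(hornerD, hornerN, hornerM) qt pt; ring.
have := IH r (leq_trans szr szq) Sr rt.
rewrite /r lift_derD; [|exact: overM|exact/overN/overM].
rewrite lift_derN; last exact: overM.
rewrite (lift_derM w SCp Sq) (lift_derM w Su Sp).
rewrite qt pt Ep !mulr0 !(add0r, addr0) oppr0 addr0 hornerC => /eqP.
by rewrite mulf_eq0 lead_coef_eq0 (negPf pn0) => /eqP.
Qed.

(** The new domain is the ring generated by [S] and [theta]. By [lift_weight], the value at
    [q.[theta]] does not depend on the choice of [q]. *)
Lemma derivation_on_extend : [pchar L] =i pred0 ->
  exists S' D', [/\ subring_set S', derivation_on S' D', S' theta &
    forall x, S x -> S' x /\ D' x = D x].
Proof.
move=> char0; have [w wker] := lift_weight char0.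
pose S' : set L := fun x => exists2 q, over S q & q.[theta] = x.
pose D' x := if pselect (S' x) is left h then lift_der w (sval (cid2 h)) else 0.
have D'E q : over S q -> D' q.[theta] = lift_der w q.
  move=> Sq; rewrite /D'; case: pselect => [h|[]]; last by exists q.
  case: cid2 => r Sr rq /=; apply/eqP; rewrite -subr_eq0.
  rewrite -lift_derN // -lift_derD //; last exact: overN.
  apply/eqP/wker; first by apply: overD => //; apply: overN.
  by rewrite hornerD hornerN rq subrr.
exists S', D'; split.
- split; first by exists 1%:P; [apply: overC; case: subS|rewrite hornerC].
    move=> _ _ [p Sp <-] [q Sq <-]; exists (p - q); last by rewrite hornerD hornerN.
    by apply: overD => //; apply: overN.
  move=> _ _ [p Sp <-] [q Sq <-]; exists (p * q); last by rewrite hornerM.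
  exact: overM.
- split=> _ _ [p Sp <-] [q Sq <-].
    by rewrite -hornerD !D'E ?lift_derD //; apply: overD.
  by rewrite -hornerM !D'E ?lift_derM //; apply: overM.
- by exists 'X; [apply: overX|rewrite hornerX].
- move=> x Sx; have Sc := overC Sx; split; first by exists x%:P => //; rewrite hornerC.
  by rewrite -[in LHS](hornerC x theta) D'E // lift_derC.
Qed.

End Extension.

Lemma derivation_on_extend_seq S D (s : seq L) : [pchar L] =i pred0 ->
  subring_set S -> derivation_on S D ->
  exists S' D', [/\ subring_set S', derivation_on S' D', forall x, x \in s -> S' x &
    forall x, S x -> S' x /\ D' x = D x].
Proof.
move=> char0; elim: s S D => [|t s IH] S D subS derD; first by exists S, D.
have [S1 [D1 [subS1 derD1 S1t S1D]]] := derivation_on_extend t subS derD char0.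
have [S2 [D2 [subS2 derD2 S2s S2D]]] := IH _ _ subS1 derD1.
exists S2, D2; split=> // [x|x /S1D[S1x <-]]; last exact: S2D.
by rewrite inE => /predU1P[->|/S2s//]; case: (S2D _ S1t).
Qed.

End Derivations.

(** * Polynomials over a subring generated by forms *)

Lemma mpoly_alg_ind (R : comNzRingType) n (P : {mpoly R[n]} -> Prop) :
  (forall c, P c%:MP) -> (forall i, P 'X_i) ->
  (forall p q, P p -> P q -> P (p + q)) ->
  (forall p q, P p -> P q -> P (p * q)) -> forall p, P p.
Proof.
move=> PC PX PD PM; elim/mpolyind => [|c m p _ _ Pp]; first exact: PC.
apply: PD => //; rewrite -mul_mpolyC; apply: (PM) => //; rewrite mpolyXE_id.
elim/big_ind: _ => [|? ?|i _]; [by rewrite -mpolyC1|exact: PM|].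
by elim: (m i) => [|k IH]; rewrite ?expr0 -?mpolyC1 // exprS; apply: PM.
Qed.

Lemma mpoly_rmorph_eq (R : comNzRingType) n (S : nzRingType)
  (F1 F2 : {rmorphism {mpoly R[n]} -> S}) :
  (forall c, F1 c%:MP = F2 c%:MP) -> (forall i, F1 'X_i = F2 'X_i) -> F1 =1 F2.
Proof.
move=> FC FX; elim/mpoly_alg_ind => [//|//|p q Ep Eq|p q Ep Eq].
  by rewrite !rmorphD Ep Eq.
by rewrite !rmorphM Ep Eq.
Qed.

Lemma idl_map_sum (A : comNzRingType) (I : eqType) (g : I -> A) (s : seq I) x :
  uniq s -> idl (map g s) x -> exists c : I -> A, x = \sum_(i <- s) c i * g i.
Proof.
elim: s x => [|i s IH] x /=; first by move=> _ ->; exists (fun=> 0); rewrite big_nil.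
move=> /andP[nis us] [c /(IH _ us)[e xE]].
exists (fun j => if j == i then c else e j); rewrite big_cons eqxx.
rewrite -[LHS](subrK (c * g i)) xE addrC; congr (_ + _).
apply: eq_big_seq => j js; case: eqP => // ji.
by rewrite -ji js in nis.
Qed.

Lemma sum_idl_map (A : comNzRingType) (I : eqType) (g : I -> A) (s : seq I)
  (P : pred I) (c : I -> A) :
  idl (map g s) (\sum_(i <- s | P i) c i * g i).
Proof.
rewrite big_seq_cond; apply: idl_sum => i /andP[si _].
by apply/idlM/idl_mem/map_f.
Qed.

Section Integrality.
Variables (n : nat) (k : fieldType) (g : 'I_n -> {mpoly k[n]}) (d : 'I_n -> nat).
Hypotheses (gd : forall i, g i \is (d i).-homog) (d_gt0 : forall i, (0 < d i)%N).
Variable m0 : nat.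
Hypothesis gtop : forall m p, (m0 <= m)%N -> p \is m.-homog ->
  idl (map g (enum 'I_n)) p.

Let cg : {mpoly k[n]} -> {mpoly k[n]} := mmap (@mpolyC n k) g.

(** The module spanned by the monomials of degree at most [m0] over the subring generated by the
    [g i]. *)
Let gen (p : {mpoly k[n]}) : Prop := exists c : 'X_{1..n < m0.+1} -> {mpoly k[n]},
  p = \sum_b cg (c b) * 'X_[b].

Let genD p q : gen p -> gen q -> gen (p + q).
Proof.
move=> [c ->] [e ->]; exists (fun b => c b + e b); rewrite -big_split /=.
by apply: eq_bigr => b _; rewrite /cg rmorphD mulrDl.
Qed.

Let genM u p : gen p -> gen (cg u * p).
Proof.
move=> [c ->]; exists (fun b => u * c b); rewrite mulr_sumr.
by apply: eq_bigr => b _; rewrite /cg rmorphM mulrA.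
Qed.

Let gen0 : gen 0.
Proof. by exists (fun=> 0); rewrite big1 // => b _; rewrite /cg rmorph0 mul0r. Qed.

Let gen_sum (I : Type) (r : seq I) (P : pred I) (F : I -> {mpoly k[n]}) :
  (forall i, P i -> gen (F i)) -> gen (\sum_(i <- r | P i) F i).
Proof. by move=> h; elim/big_ind: _. Qed.

(** From degree [m0] on, a form is a combination of the [g i] whose coefficients can be taken to be
    forms of smaller degree, because the [d i] are positive. Below [m0] its own monomials
    suffice. *)
Let gen_homog m p : p \is m.-homog -> gen p.
Proof.
have [b] := ubnP m; elim: b m p => // b IH m p mb pm.
have [m0m|mm0] := leqP m0 m.
  have [c pE] := idl_map_sum (enum_uniq _) (gtop m0m pm).
  have -> : p = \sum_(i <- enum 'I_n) pihomog mdeg m (c i * g i).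
    by rewrite -[LHS](pihomog_dE pm) pE raddf_sum.
  apply: gen_sum => i _; rewrite (pihomogMr _ _ (gd i)).
  case: ifP => // dm.
  have -> : g i = cg 'X_i by rewrite /cg mmapX mmap1U.
  rewrite mulrC; apply: genM; apply: (IH (m - d i)%N); last exact: pihomogP.
  by move: mb dm (d_gt0 i); lia.
exists (fun b => (p@_b)%:MP).
have psz : (msize p <= m0.+1)%N.
  rewrite msizeE; apply/bigmax_leqP_seq => t tp _.
  by rewrite (dhomogP _ _ _ pm) // ltnS ltnW.
rewrite {1}(mpolywE psz); apply: eq_bigr => t _.
by rewrite /cg mmapC mul_mpolyC.
Qed.

Lemma finite_over_forms p : exists c : 'X_{1..n < m0.+1} -> {mpoly k[n]},
  p = \sum_b mmap (@mpolyC n k) g (c b) * 'X_[b].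
Proof.
rewrite (pihomog_partitionE (leqnn (msize p))).
by apply: gen_sum => i _; apply/gen_homog/pihomogP.
Qed.

Variables (L : fieldType) (ev : {rmorphism {mpoly k[n]} -> L}) (v : 'I_n -> L).
Hypothesis char0 : [pchar L] =i pred0.

(** The derivation along [ev] that vanishes on constants and sends ['X_j] to [v j]. *)
Definition dev (p : {mpoly k[n]}) : L := \sum_j ev (p^`M(j)) * v j.

Lemma devM p q : dev (p * q) = dev p * ev q + ev p * dev q.
Proof.
rewrite /dev mulr_suml mulr_sumr -big_split /=; apply: eq_bigr => j _.
by rewrite mderivM rmorphD !rmorphM; ring.
Qed.

Lemma devD p q : dev (p + q) = dev p + dev q.
Proof.
rewrite /dev -big_split /=; apply: eq_bigr => j _.
by rewrite mderivD rmorphD mulrDl.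
Qed.

Lemma devC c : dev c%:MP = 0.
Proof. by rewrite /dev big1 // => j _; rewrite mderivC rmorph0 mul0r. Qed.

Lemma mderivXU (i j : 'I_n) : ('X_i : {mpoly k[n]})^`M(j) = (i == j)%:R.
Proof.
rewrite mderivX mnm1E; case: eqP => [->|_]; last by rewrite scale0r.
by rewrite scale1r -[X in (X - _)%MM]add0m addmK mpolyX0.
Qed.

Lemma devX i : dev 'X_i = v i.
Proof.
rewrite /dev (bigD1 i) //= mderivXU eqxx rmorph1 mul1r big1 ?addr0 // => j ji.
by rewrite mderivXU eq_sym (negPf ji) rmorph0 mul0r.
Qed.

Hypothesis dev_ker : forall p, ev p = 0 -> dev p = 0.
Hypothesis dev_g : forall i, dev (g i) = 0.

Let dev_cg u : dev (cg u) = 0.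
Proof.
rewrite /cg; elim/mpoly_alg_ind: u => [c|i|p q|p q].
- by rewrite mmapC devC.
- by rewrite mmapX mmap1U dev_g.
- by rewrite rmorphD devD => -> ->; rewrite addr0.
- by rewrite rmorphM devM => -> ->; rewrite mulr0 mul0r addr0.
Qed.

Let h : {rmorphism {mpoly k[n]} -> L} := ev \o (mmap (@mpolyC n k) g).

(** Multiplication by ['X_i] on the finite spanning family of monomials is given by a matrix [Q]
    over the subring generated by the [g i]. The evaluated monomials form an eigenvector for
    [ev 'X_i], nonzero because of the monomial 1, so the monic characteristic polynomial vanishes
    there. *)
Let eval_root i : exists2 p : {poly {mpoly k[n]}}, map_poly h p != 0 &
  root (map_poly h p) (ev 'X_i).
Proof.
have /choice[c cE] : forall b : 'X_{1..n < m0.+1}, exists c : 'X_{1..n < m0.+1} -> {mpoly k[n]},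
  'X_i * 'X_[b] = \sum_b' mmap (@mpolyC n k) g (c b') * 'X_[b'].
  by move=> b; apply: finite_over_forms.
pose N := #|{: 'X_{1..n < m0.+1}}|.
pose mon (t : 'I_N) : 'X_{1..n < m0.+1} := enum_val t.
pose Q : 'M[{mpoly k[n]}]_N := \matrix_(s, t) c (mon t) (mon s).
exists (char_poly Q).
  by apply/monic_neq0/monic_map/char_poly_monic.
rewrite map_char_poly -eigenvalue_root_char; apply/eigenvalueP.
exists (\row_t ev 'X_[mon t]); last first.
  have lt0 : (mdeg (0%MM : 'X_{1..n}) < m0.+1)%N by rewrite mdeg0.
  apply/eqP => /rowP /(_ (enum_rank (BMultinom lt0))).
  rewrite !mxE /mon enum_rankK mpolyX0 rmorph1.
  by move=> /eqP; rewrite oner_eq0.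
apply/rowP => t; rewrite !mxE -rmorphM cE rmorph_sum.
rewrite [RHS](reindex_onto mon enum_rank) /=; last by move=> *; apply: enum_rankK.
rewrite [RHS](eq_bigl xpredT) => [|s]; last by rewrite /mon enum_valK eqxx.
by apply: eq_bigr => s _; rewrite !mxE rmorphM mulrC.
Qed.

(** Take [p] of minimal degree over the subring generated by the [g i] with [ev 'X_i] as a root. As
    [dev] kills this subring, applying it to the value of [p] at ['X_i] leaves [v i] times the
    derivative of [p] at [ev 'X_i], which is nonzero by minimality in characteristic zero. *)
Lemma dev_integral i : v i = 0.
Proof.
pose kills (p : {poly {mpoly k[n]}}) :=
  (map_poly h p != 0) && root (map_poly h p) (ev 'X_i).
pose szp l := `[< exists2 p, kills p & size (map_poly h p) = l >].
have exl : exists l, szp l.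
  have [p pn0 rp] := eval_root i; exists (size (map_poly h p)).
  by apply/asboolP; exists p => //; rewrite /kills pn0.
have [l /asboolP[p /andP[pn0 rp] szl] lmin] := ex_minnP exl; subst l.
have sz_gt1 : (1 < size (map_poly h p))%N := root_size_gt1 pn0 rp.
have dp0 : (map_poly h p)^`().[ev 'X_i] != 0.
  apply/eqP => dp0.
  have dn0 : (map_poly h p)^`() != 0.
    apply/eqP => /(congr1 (fun q : {poly L} => q`_(size (map_poly h p)).-2)).
    rewrite coef_deriv coef0.
    have -> : (size (map_poly h p)).-2.+1 = (size (map_poly h p)).-1.
      by case: (size (map_poly h p)) sz_gt1 => [|[]].
    move/eqP; rewrite -mulr_natr mulf_eq0 lead_coef_eq0 (negPf pn0) /=.
    rewrite (proj1 (pcharf0P L) char0) => /eqP.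
    by case: (size (map_poly h p)) sz_gt1 => [|[]].
  have := lmin (size (map_poly h p)^`()).
  rewrite leqNgt lt_size_deriv // => /(_ _)/negP; apply => //.
  apply/asboolP; exists p^`(); rewrite /kills -?deriv_map // dn0 /=.
  exact/eqP.
have key q : dev (map_poly (mmap (@mpolyC n k) g) q).['X_i]
    = (map_poly h q)^`().[ev 'X_i] * v i.
  elim/poly_ind: q => [|q c IH].
    by rewrite !rmorph0 deriv0 !horner0 mul0r -mpolyC0 devC.
  rewrite !rmorphD !rmorphM /= !map_polyX !map_polyC hornerMXaddC.
  rewrite derivMXaddC hornerD hornerM hornerX devD devM IH devX.
  rewrite [dev (mmap _ _ _)]dev_cg -horner_map /=.
  have -> : map_poly ev (map_poly (mmap (@mpolyC n k) g) q) = map_poly h q.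
    by rewrite -map_poly_comp.
  by ring.
have := key p; rewrite dev_ker.
  by move/esym/eqP; rewrite mulf_eq0 (negPf dp0) => /eqP.
rewrite -horner_map -map_poly_comp; exact/eqP.
Qed.

End Integrality.

(** * The Jacobian argument *)

Lemma euler_homog (R : comNzRingType) n d (p : {mpoly R[n]}) :
  p \is d.-homog -> \sum_j 'X_j * p^`M(j) = d%:R *: p.
Proof.
move=> pd; rewrite [in RHS](mpolyE p) scaler_sumr.
have -> : \sum_j 'X_j * p^`M(j)
    = \sum_(m <- msupp p) \sum_j p@_m *: ('X_j * ('X_[m])^`M(j)).
  rewrite exchange_big /=; apply: eq_bigr => j _.
  rewrite {1}(mpolyE p) linear_sum mulr_sumr /=; apply: eq_bigr => m _.
  by rewrite linearZ /= -scalerAr.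
rewrite big_seq [RHS]big_seq; apply: eq_bigr => m mp.
rewrite -scaler_sumr scalerA mulrC -scalerA; congr (_ *: _).
have <- : mdeg m = d by apply: (dhomogP _ _ _ pd).
rewrite mdegE natr_sum scaler_suml; apply: eq_bigr => j _.
rewrite mderivX -scalerAr; have [->|mj] := eqVneq (m j) 0%N; first by rewrite !scale0r.
by rewrite -mpolyXD addmC submK // lep1mP.
Qed.

Section Core.
Variables (n : nat) (k : fieldType) (g : 'I_n -> {mpoly k[n]}) (d : 'I_n -> nat).
Hypotheses (gd : forall i, g i \is (d i).-homog) (d_gt0 : forall i, (0 < d i)%N).
Variable m0 : nat.
Hypothesis gtop : forall m p, (m0 <= m)%N -> p \is m.-homog ->
  idl (map g (enum 'I_n)) p.
Variables (L : fieldType) (eps : {rmorphism k -> L}) (xi z : 'I_n -> L).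
Hypothesis char0 : [pchar L] =i pred0.

Let ev : {rmorphism {mpoly k[n]} -> L} := mmap eps z.
Let E : {rmorphism {mpoly k[n]} -> L} := mmap eps xi.
Hypothesis E_inj : injective E.

Let evX i : ev 'X_i = z i. Proof. by rewrite /= mmapX mmap1U. Qed.
Let evC c : ev c%:MP = eps c. Proof. by rewrite /= mmapC. Qed.

Lemma chain_rule (S : set L) (D : L -> L) : subring_set S -> derivation_on S D ->
  (forall c, S (eps c) /\ D (eps c) = 0) -> (forall j, S (z j)) ->
  forall p, S (ev p) /\ D (ev p) = dev ev (D \o z) p.
Proof.
move=> subS derD Dc Sz; have [S1 SB SM] := subS; have [DD DM] := derD.
elim/mpoly_alg_ind => [c|i|p q [Sp Dp] [Sq Dq]|p q [Sp Dp] [Sq Dq]].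
- by rewrite evC devC; apply: Dc.
- by rewrite evX devX.
- rewrite rmorphD devD -Dp -Dq; split; last exact: DD.
  exact: (subring_setD subS).
- by rewrite rmorphM devM -Dp -Dq; split; [apply: SM|apply: DM].
Qed.

(** Injectivity of [E] makes the derivative along xi_l well defined on the image of [E]; it is then
    extended to a subring containing the [z j]. *)
Lemma partial_derivation (l : 'I_n) : exists S D,
  [/\ subring_set S, derivation_on S D,
      forall p, S (E p) /\ D (E p) = E p^`M(l) & forall j, S (z j)].
Proof.
pose S0 : set L := fun x => exists p, E p = x.
pose D0 x := if pselect (S0 x) is left h then E (sval (cid h))^`M(l) else 0.
have D0E p : D0 (E p) = E p^`M(l).
  rewrite /D0; case: pselect => [h|[]]; last by exists p.
  by congr (E _^`M(l)); apply: E_inj; exact: (svalP (cid h)).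
have sub0 : subring_set S0.
  split; first by exists 1; rewrite rmorph1.
    by move=> _ _ [p <-] [q <-]; exists (p - q); rewrite rmorphB.
  by move=> _ _ [p <-] [q <-]; exists (p * q); rewrite rmorphM.
have der0 : derivation_on S0 D0.
  split=> _ _ [p <-] [q <-]; first by rewrite -rmorphD !D0E mderivD rmorphD.
  by rewrite -rmorphM !D0E mderivM rmorphD !rmorphM.
have [S [D [subS derD Sz SD]]] := derivation_on_extend_seq (codom z) char0 sub0 der0.
exists S, D; split=> // [p|j]; last by apply/Sz/codom_f.
by have [|? ->] := SD (E p); [by exists p|rewrite D0E].
Qed.

(* With Z the matrix of the derivatives of z along xi, and J the truncated
   Jacobian matrix at z, differentiating the equations shows that a vector
   killing Z J kills Z (the z_j being algebraic over the g_i (z)), hence J.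
   So J and Z J have the same row space. This is absurd: by Euler's formula,
   the entry i0 of z J is d_i0, and the column i0 of Z J vanishes. *)
Theorem no_critical_zero (i0 : 'I_n) :
  (forall j : 'I_n, (j <= i0)%N -> \sum_l xi l * ev (g j)^`M(l) = 0) ->
  (forall j : 'I_n, (i0 < j)%N -> ev (g j) = 0) ->
  ev (g i0) = 1 -> False.
Proof.
move=> crit zero one.
have /choice[S /choice[D SD]] := partial_derivation.
have chain l p : S l (ev p) /\ D l (ev p) = dev ev (D l \o z) p.
  have [subS derD DE Sz] := SD l; apply: chain_rule => // c.
  by have := DE c%:MP; rewrite /= mmapC mderivC mmap0.
have Dxi l j : S l (xi j) /\ D l (xi j) = (l == j)%:R.
  have [_ _ DE _] := SD l; have := DE 'X_j; rewrite mderivXU eq_sym.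
  by rewrite rmorph_nat /= mmapX mmap1U.
have D1 l : D l 1 = 0.
  have [_ _ DE _] := SD l; have := DE 1; rewrite rmorph1 -mpolyC1 mderivC rmorph0.
  by case.
have D0 l : D l 0 = 0 by have [subS derD _ _] := SD l; apply: derivation_on0 subS derD.
pose Z := \matrix_(l, j) D l (z j).
pose J := \matrix_(l, j < n) (if (j <= i0)%N then ev (g j)^`M(l) else 0).
pose H := \matrix_(l, j < n)
  (if (j <= i0)%N then \sum_m xi m * ev (g j)^`M(m)^`M(l) else 0).
(* This is the derivative along xi_l of the j-th equation in [crit]: the explicit xi contributes
   [J], and the dependence of [z] on xi contributes [Z *m H]. *)
have JE : J = - (Z *m H).
  apply/matrixP => l j; rewrite !mxE; case: (leqP j i0) => [ji|ij]; last first.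
    by rewrite big1 ?oppr0 // => m _; rewrite !mxE leqNgt ij mulr0.
  have [subS derD _ Sz] := SD l; have [_ _ SM] := subS; have [_ DM] := derD.
  have := congr1 (D l) (crit j ji).
  rewrite D0 (derivation_on_sum subS derD); last first.
    by move=> m _; apply: SM; [case: (Dxi l m)|case: (chain l (g j)^`M(m))].
  rewrite (eq_bigr (fun m => (l == m)%:R * ev (g j)^`M(m)
      + \sum_q Z l q * (xi m * ev (g j)^`M(m)^`M(q)))); last first.
    move=> m _; have [Sx Dx] := Dxi l m; have [Sg Dg] := chain l (g j)^`M(m).
    rewrite DM // Dx Dg /dev mulr_sumr; congr (_ + _); apply: eq_bigr => q _.
    by rewrite mxE /=; ring.
  rewrite big_split /= (bigD1 l) //= eqxx mul1r big1 ?addr0; last first.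
    by move=> m ml; rewrite eq_sym (negPf ml) mul0r.
  rewrite exchange_big /= => /eqP; rewrite addr_eq0 => /eqP ->; congr (- _).
  by apply: eq_bigr => q _; rewrite !mxE ji mulr_sumr.
have ker c : c *m (Z *m J) = 0 -> c *m J = 0 :> 'rV_n.
  move=> cZJ; suff cZ : c *m Z = 0 by rewrite JE mulmxN mulmxA cZ mul0mx oppr0.
  pose v j := (c *m Z) 0 j.
  have devE p : dev ev v p = \sum_l c 0 l * D l (ev p).
    rewrite (eq_bigr (fun l => \sum_j ev p^`M(j) * (c 0 l * Z l j))); last first.
      move=> l _; have [_ ->] := chain l p; rewrite /dev mulr_sumr.
      by apply: eq_bigr => j _; rewrite mxE /=; ring.
    by rewrite exchange_big; apply: eq_bigr => j _; rewrite /v mxE mulr_sumr.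
  have dev_ker p : ev p = 0 -> dev ev v p = 0.
    by move=> p0; rewrite devE big1 // => l _; rewrite p0 D0 mulr0.
  (* For [i <= i0] this is the entry [i] of [c *m (Z *m J)]; for larger [i], [g i] vanishes at
     [z]. *)
  have dev_g i : dev ev v (g i) = 0.
    have [ii0|/zero/dev_ker//] := leqP i i0.
    transitivity ((c *m (Z *m J)) 0 i); last by rewrite cZJ mxE.
    by rewrite mulmxA mxE; apply: eq_bigr => l _; rewrite [J _ _]mxE ii0 mulrC.
  apply/rowP => i; rewrite [RHS]mxE.
  exact: (dev_integral gd d_gt0 gtop char0 dev_ker dev_g).
have JW : (J <= Z *m J)%MS.
  (* The inclusion of kernels bounds the rank of [J] by that of [Z *m J]. The row space of the
     latter lies in that of [J], so the two coincide. *)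
  have kerW : (kermx (Z *m J) <= kermx J)%MS.
    by apply/rV_subP => c /sub_kermxP/ker c0; apply/sub_kermxP.
  have := mxrankS kerW; rewrite !mxrank_ker leq_sub2lE ?rank_leq_row // => rk.
  rewrite -(mxrank_leqif_sup (submxMl Z J)) eqn_leq rk andbT.
  exact: mxrankS (submxMl Z J).
have /submxP[c cE] : ((\row_j z j) *m J <= Z *m J)%MS.
  exact: submx_trans (submxMl _ _) JW.
have := congr1 (fun u : 'rV_n => u 0 i0) cE.
have -> : (c *m (Z *m J)) 0 i0 = 0.
  rewrite mxE big1 // => l _.
  suff -> : (Z *m J) l i0 = 0 by rewrite mulr0.
  have := chain l (g i0); rewrite one D1 => -[_ dev0].
  rewrite [RHS]dev0 /dev mxE; apply: eq_bigr => j _.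
  by rewrite !mxE leqnn mulrC.
have <- : (d i0)%:R = ((\row_j z j) *m J) 0 i0.
  have := congr1 ev (euler_homog (gd i0)).
  rewrite -mul_mpolyC rmorphM evC one mulr1 rmorph_nat rmorph_sum => <-.
  rewrite mxE; apply: eq_bigr => j _.
  by rewrite !mxE leqnn rmorphM evX.
by move/eqP; rewrite (proj1 (pcharf0P L) char0) -leqn0 leqNgt d_gt0.
Qed.

End Core.

(** * Extension of the base field to k(xi) *)

Section ClearDenominators.
Variables (P : idomainType) (n : nat).
Local Notation K := {fraction P}.
Local Notation tau := (map_mpoly (@FracField.tofrac P) : {mpoly P[n]} -> {mpoly K[n]}).

Lemma fraction_denominator (x : K) : exists2 q : P, q != 0 & exists p, tofrac q * x = tofrac p.
Proof.
elim/quotW: x => x; exists (\d_x); first exact: denom_ratioP.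
exists (\n_x); unlock FracField.tofrac; rewrite -[LHS]FracField.pi_mul.
apply/eqP; rewrite FracField.equivf_def /FracField.mulf.
have d0 := denom_ratioP x.
by rewrite !numden_Ratio ?mul1r ?mulr1 ?oner_neq0 // mulrC.
Qed.

Lemma mpoly_denominator (p : {mpoly K[n]}) :
  exists2 q : P, q != 0 & exists p', (tofrac q)%:MP * p = tau p'.
Proof.
elim/mpolyind: p => [|c m p _ _ [q qn0 [p' pE]]].
  by exists 1; rewrite ?oner_eq0 //; exists 0; rewrite mulr0 rmorph0.
have [e en0 [c' cE]] := fraction_denominator c.
exists (e * q); rewrite ?mulf_neq0 //.
exists ((q * c') *: 'X_[m] + e *: p').
rewrite rmorphD /= !map_mpolyZ map_mpolyX -pE tofracM mpolyCM mulrDr.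
rewrite -!mulrA !mul_mpolyC rmorphM /= -cE !scalerA; congr (_ *: _ + _).
by rewrite -mulrA mulrCA.
Qed.

(** The denominators of the coefficients are cleared one generator at a time. *)
Lemma idl_denominator (l : seq {mpoly P[n]}) b :
  idl (map tau l) (tau b) -> exists2 q : P, q != 0 & idl l (q *: b).
Proof.
elim: l b => [|f l IH] b /=.
  move=> b0; exists 1; rewrite ?oner_eq0 // scale1r; apply/mpolyP => m.
  move/mpolyP/(_ m): b0; rewrite mcoeff_map_mpoly !mcoeff0 => /eqP.
  by rewrite tofrac_eq0 => /eqP.
move=> [c bc]; have [q qn0 [c' cE]] := mpoly_denominator c.
have /IH[e en0 be] : idl (map tau l) (tau (q *: b - c' * f)).
  have := idlM ((tofrac q)%:MP) bc; congr idl.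
  by rewrite raddfB /= map_mpolyZ rmorphM /= -cE -mulrA -mul_mpolyC -mulrBr.
exists (e * q); rewrite ?mulf_neq0 //; exists (e *: c').
by rewrite -scalerA -scalerAl -scalerBr.
Qed.

End ClearDenominators.

Section BaseChange.
Variables (n : nat) (k : fieldType).
Local Notation P := {mpoly k[n]}.
Local Notation K := {fraction P}.
Local Notation tau := (map_mpoly (@FracField.tofrac P) : {mpoly P[n]} -> {mpoly K[n]}).
Local Notation phi := (map_mpoly (@mpolyC n k) : {mpoly k[n]} -> {mpoly P[n]}).

(* The coefficient of xi ^ a, for polynomials in y over k[xi]. *)
Local Notation slice a := (map_mpoly (mcoeff a) : {mpoly P[n]} -> {mpoly k[n]}).

Lemma sliceM a b f : slice a (b * phi f) = slice a b * f.
Proof.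
apply/mpolyP => m; rewrite mcoeff_map_mpoly !mcoeffM raddf_sum /=.
apply: eq_bigr => -[m1 m2] _; rewrite !mcoeff_map_mpoly /=.
by rewrite mulrC mcoeffCM mulrC.
Qed.

Lemma sliceE (b : {mpoly P[n]}) :
  exists s : seq 'X_{1..n}, b = \sum_(a <- s) 'X_[a] *: phi (slice a b).
Proof.
pose s := undup (flatten [seq msupp b@_m | m <- msupp b]).
exists s; apply/mpolyP => m; rewrite raddf_sum /=.
rewrite (eq_bigr (fun a => (b@_m)@_a *: 'X_[a])); last first.
  by move=> a _; rewrite mcoeffZ !mcoeff_map_mpoly mulrC mul_mpolyC.
have [bm0|bm] := eqVneq b@_m 0.
  by rewrite bm0 big1 // => a _; rewrite mcoeff0 scale0r.
have subs : {subset msupp b@_m <= s}.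
  move=> a am; rewrite mem_undup; apply/flattenP; exists (msupp b@_m) => //.
  by apply: map_f; rewrite mcoeff_msupp.
rewrite {1}(mpolyE b@_m) [RHS](bigID (mem (msupp b@_m))) /= [X in _ = _ + X]big1 ?addr0.
  rewrite -[RHS]big_filter; apply: perm_big; apply: uniq_perm.
  - exact: msupp_uniq.
  - by rewrite filter_uniq ?undup_uniq.
  - by move=> a; rewrite mem_filter; case: (boolP (a \in _)) => // /subs ->.
by move=> a /memN_msupp_eq0->; rewrite scale0r.
Qed.

Lemma idl_slice l b : idl (map phi l) b -> forall a, idl l (slice a b).
Proof.
elim: l b => [|f l IH] b /=; first by move=> -> a; rewrite raddf0.
move=> [c /IH bc] a; exists (slice a c).
by have := bc a; rewrite raddfB /= sliceM.
Qed.

(** The ring k[xi][y] is free over k[y] on the monomials in xi, so membership in an extended ideal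
    can be tested slice by slice. *)
Lemma idl_unslice l b : (forall a, idl l (slice a b)) -> idl (map phi l) b.
Proof.
move=> h; have [s ->] := sliceE b; apply: idl_sum => a _.
by rewrite -mul_mpolyC; apply/idlM/idl_map.
Qed.

(** Flatness of k(xi)[y] over k[y]: denominators are cleared, and the hypothesis is applied to each
    slice. *)
Lemma nzd_base_change (l : seq {mpoly k[n]}) f :
  nzd l f -> nzd (map (tau \o phi) l) (tau (phi f)).
Proof.
move=> nf a af; have [q qn0 [a' aE]] := mpoly_denominator a.
have : idl (map tau (map phi l)) (tau (a' * phi f)).
  by rewrite rmorphM /= -aE -map_comp -mulrA; apply: idlM.
move=> /idl_denominator[e en0 /idl_slice ea'].
have : idl (map phi l) (e *: a').
  apply: idl_unslice => x; apply: nf.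
  by have := ea' x; rewrite scalerAl sliceM.
move=> /(idl_map (map_mpoly (@FracField.tofrac P))).
rewrite -map_comp /= map_mpolyZ -aE => h.
have u : tofrac e * tofrac q != 0 by rewrite mulf_neq0 // tofrac_eq0.
have -> : a = ((tofrac e * tofrac q)^-1)%:MP * (tofrac e *: ((tofrac q)%:MP * a)).
  by rewrite !mul_mpolyC !scalerA -mulrA mulVf // scale1r.
exact: idlM.
Qed.

Lemma reg_base_change (l : seq {mpoly k[n]}) : reg l -> reg (map (tau \o phi) l).
Proof. by elim: l => //= f l IH [/IH rl /nzd_base_change]. Qed.

End BaseChange.

Lemma dhomog_map_mpoly (R S : nzRingType) n (f : {rmorphism R -> S}) d (p : {mpoly R[n]}) :
  p \is d.-homog -> map_mpoly f p \is d.-homog.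
Proof.
move=> pd; apply/dhomogP => m; rewrite mcoeff_msupp mcoeff_map_mpoly => pm.
apply: (dhomogP _ _ _ pd); rewrite mcoeff_msupp.
by apply: contraNneq pm => ->; rewrite raddf0.
Qed.

Lemma dhomog_mderiv (R : nzRingType) n d (p : {mpoly R[n]}) i :
  p \is d.-homog -> p^`M(i) \is d.-1.-homog.
Proof.
move=> pd; apply/dhomogP => m; rewrite mcoeff_msupp mcoeff_deriv => pm.
have : mdeg (m + U_(i))%MM = d.
  apply: (dhomogP _ _ _ pd); rewrite mcoeff_msupp.
  by apply: contraNneq pm => ->; rewrite mul0rn.
by rewrite mdegD mdeg1 addn1 => <-.
Qed.

(** * Derivatives in a generic direction *)

Lemma mem_split (T : eqType) (x : T) s : x \in s -> exists l1 l2, s = l1 ++ x :: l2.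
Proof. by case/splitPr=> l1 l2; exists l1, l2. Qed.

Section Trade.
Variables (n N : nat) (R : comNzRingType) (u v : 'I_N -> {mpoly R[n]}) (s : seq 'I_N).
Hypotheses (uh : forall j, exists2 d, (0 < d)%N & u j \is d.-homog)
  (vh : forall j, exists2 d, (0 < d)%N & v j \is d.-homog).
Hypotheses (us : uniq s) (ms : forall j, j \in s).
Hypothesis u_nilpotent : forall (l : seq {mpoly R[n]}) (i0 : 'I_N), homogs l ->
  (forall j : 'I_N, (j <= i0)%N -> v j \in l) ->
  (forall j : 'I_N, (i0 < j)%N -> u j \in l) -> exists M, idl l (u i0 ^+ M).

Let mix i (j : 'I_N) := if (j < i)%N then v j else u j.

Let mix_phomogs i t : phomogs (map (mix i) t).
Proof. by move=> _ /mapP[j _ ->]; rewrite /mix; case: ifP. Qed.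

(** Going from [mix i] to [mix i.+1] changes only the entry of index [i]. That entry is rotated to
    the head, exchanged by means of the nilpotency of [u i0], and rotated back. *)
Lemma reg_trade : reg (map u s) -> reg (map v s).
Proof.
move=> reg_u; suff /(_ N) : forall i, reg (map (mix i) s).
  by congr reg; apply: eq_map => i; rewrite /mix ltn_ord.
elim=> [|i IH]; first exact: reg_u.
have [ni|i_ge] := ltnP i N; last first.
  rewrite (eq_map (g := mix i)) // => j; rewrite /mix.
  by rewrite !(leq_trans (ltn_ord j)) // ltnW.
pose i0 := Ordinal ni.
have [l1 [l2 eE]] := mem_split (ms i0).
have := us; rewrite eE cat_uniq /= => /and3P[_ /norP[i0l1 _] /andP[i0l2 _]].
have mixE l : i0 \notin l -> map (mix i.+1) l = map (mix i) l.
  move=> i0l; apply/eq_in_map => j jl; rewrite /mix ltnS leq_eqVlt.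
  have -> // : (j == i :> nat) = false.
  by apply: contraNF i0l => /eqP ji; rewrite (_ : i0 = j) //; apply: val_inj.
have mixg : mix i i0 = u i0 by rewrite /mix ltnn.
have mixs : mix i.+1 i0 = v i0 by rewrite /mix ltnSn.
set m1 := map (mix i) l1; set m2 := map (mix i) l2.
have hg : phomogs (u i0 :: m1 ++ m2).
  by rewrite -mixg -map_cat -map_cons; apply: mix_phomogs.
have hs : phomogs (v i0 :: m1 ++ m2).
  by rewrite -mixs /m1 /m2 -!mixE // -map_cat -map_cons; apply: mix_phomogs.
move: IH; rewrite {1}eE !map_cat !map_cons mixg mixs !mixE //.
move=> /(reg_rot hg) rg; apply/(reg_rot hs).
have memE (j : 'I_N) : j != i0 -> mix i j \in m1 ++ m2.
  move=> ji0; have := ms j; rewrite eE mem_cat inE (negPf ji0) /= mem_cat => /orP[jl|jl].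
    by rewrite (map_f (mix i) jl).
  by rewrite (map_f (mix i) jl) orbT.
have [||M gM] := u_nilpotent (l := v i0 :: m1 ++ m2) (i0 := i0) (phomogsW hs).
- move=> j; rewrite leq_eqVlt inE => /predU1P[ji|ji].
    by rewrite (_ : j = i0) ?eqxx //; apply: val_inj.
  rewrite -[v j](_ : mix i j = _) ?memE ?orbT //; last by rewrite /mix ji.
  by rewrite -val_eqE ltn_eqF.
- move=> j ji; rewrite inE -[u j](_ : mix i j = _) ?memE ?orbT //.
    by rewrite -val_eqE gtn_eqF.
  by rewrite /mix ltnNge ltnW.
exact: reg_exchange rg gM.
Qed.

End Trade.

Section GenericDirection.
Variables (n' : nat).
Local Notation n := n'.+1.
Variables (k : fieldType).
Hypothesis char0 : [pchar k] =i pred0.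
Variables (g : 'I_n -> {mpoly k[n]}) (d : 'I_n -> nat).
Hypotheses (gd : forall i, g i \is (d i).-homog) (d_gt0 : forall i, (0 < d i)%N).
Local Notation e := (rev (enum 'I_n)).
Hypothesis reg_g : reg (map g e).
Local Notation P := {mpoly k[n]}.
Local Notation K := {fraction P}.
Local Notation tau := (map_mpoly (@FracField.tofrac P) : {mpoly P[n]} -> {mpoly K[n]}).
Local Notation phi := (map_mpoly (@mpolyC n k) : {mpoly k[n]} -> {mpoly P[n]}).

(* The derivative of [g i] in the generic direction xi. *)
Definition xideriv i : {mpoly P[n]} := \sum_l 'X_l *: phi (g i)^`M(l).

Let gK i : {mpoly K[n]} := tau (phi (g i)).
Let sK i : {mpoly K[n]} := tau (xideriv i).

Let gK_homog i : gK i \is (d i).-homog.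
Proof. by do 2!apply: dhomog_map_mpoly. Qed.

Let sK_homog i : sK i \is (d i).-1.-homog.
Proof.
apply: dhomog_map_mpoly; rewrite /xideriv rpred_sum // => l _.
by apply/rpredZ/dhomog_map_mpoly/dhomog_mderiv.
Qed.

Let reg_gK : reg (map gK e).
Proof. by have := reg_base_change reg_g; rewrite -map_comp. Qed.

Lemma enum_rev_sum (F : 'I_n -> nat) : \sum_(i <- e) F i = \sum_i F i.
Proof. by rewrite (perm_big (enum 'I_n)) ?perm_rev // big_enum. Qed.

(** This supplies the degree [m0] of the integrality argument. *)
Lemma regular_top m p : (\sum_i d i <= m)%N -> p \is m.-homog ->
  idl (map g (enum 'I_n)) p.
Proof.
move=> dm pm; pose l := [seq (g i, d i) | i <- e].
have fstl : map fst l = map g e by rewrite -map_comp.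
have : idl (map fst l) p.
  apply: (@reg_topdeg _ _ _ m); rewrite ?fstl //.
  - by move=> _ /mapP[i _ ->]; apply: gd.
  - by rewrite size_map size_rev size_enum_ord.
  - by rewrite big_map enum_rev_sum addnS ltnS (leq_trans dm) // leq_addr.
by rewrite fstl; apply: idl_mem_sub => f; rewrite map_rev mem_rev.
Qed.

(** Otherwise, by [idl_dehomog], adding the equation [gK i0 = 1] to [l] leaves a proper ideal. It
    has a zero [z] in a field containing [K], which [no_critical_zero] excludes. *)
Lemma xideriv_nilpotent (l : seq {mpoly K[n]}) (i0 : 'I_n) : homogs l ->
  (forall j : 'I_n, (j <= i0)%N -> sK j \in l) ->
  (forall j : 'I_n, (i0 < j)%N -> gK j \in l) ->
  exists M, idl l (gK i0 ^+ M).
Proof.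
move=> hl sl gl; apply: contrapT => nM.
have : ~ idl (gK i0 - 1 :: l) 1.
  by move=> /(idl_dehomog hl (d_gt0 i0) (gK_homog i0)).
move=> /field_of_proper_ideal[L [h hl0]].
pose inj : {rmorphism K -> L} := h \o (@mpolyC n K).
pose cst : {rmorphism k -> L} := inj \o (@FracField.tofrac P \o @mpolyC n k).
pose xi l := inj (FracField.tofrac 'X_l).
pose z l := h 'X_l.
have evE p : mmap cst z p = h (tau (phi p)).
  pose F : {rmorphism {mpoly k[n]} -> L} :=
    h \o (map_mpoly (@FracField.tofrac P) \o map_mpoly (@mpolyC n k)).
  apply: (@mpoly_rmorph_eq _ _ _ (mmap cst z) F) => [c|i].
    by apply: etrans (mmapC _ _ _) _; rewrite /= !map_mpolyC.
  apply: etrans (mmapX _ _ _) _; apply: etrans (mmap1U _ _) _.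
  by rewrite /= !map_mpolyX.
have EE p : mmap cst xi p = inj (FracField.tofrac p).
  apply: (@mpoly_rmorph_eq _ _ _ (mmap cst xi) (inj \o @FracField.tofrac P)) => [c|i].
    exact: mmapC.
  exact: etrans (mmapX _ _ _) (mmap1U _ _).
have Einj : injective (mmap cst xi : {mpoly k[n]} -> L).
  by move=> p q; rewrite !EE => /fmorph_inj/eqP; rewrite tofrac_eq => /eqP.
have charL : [pchar L] =i pred0.
  by move=> p; rewrite (fmorph_pchar cst); apply: char0.
apply: (no_critical_zero gd d_gt0 regular_top charL Einj (z := z) (i0 := i0)) => [j ji|j ij|].
- have := hl0 _ (mem_behead (s := _ :: _) (sl j ji)).
  have -> : sK j = \sum_t tau ('X_t *: phi (g j)^`M(t)) by apply: raddf_sum.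
  rewrite rmorph_sum => h0; rewrite -[RHS]h0.
  apply: eq_bigr => t _; rewrite map_mpolyZ -mul_mpolyC rmorphM.
  by congr (_ * _); apply: evE.
- by apply: etrans (evE _) _; apply: (hl0 _ (mem_behead (s := _ :: _) (gl j ij))).
- apply: etrans (evE _) _; apply/eqP; rewrite -subr_eq0 -(rmorph1 h) -rmorphB; apply/eqP.
  by apply: hl0; rewrite mem_head.
Qed.

Hypothesis d_gt1 : forall i, (1 < d i)%N.

(** The forms [sK i] have degree [(d i).-1], which is positive here as [reg_trade] requires; the
    bound of [reg_topdeg] becomes that [m] exceeds the sum of the [d i - 2]. *)
Lemma xideriv_top_gt1 m p : (\sum_i d i < m + n.*2)%N -> p \is m.-homog ->
  idl (map sK e) p.
Proof.
move=> dm pm; pose l := [seq (sK i, (d i).-1) | i <- e].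
have fstl : map fst l = map sK e by rewrite -map_comp.
have {}dm : (\sum_i (d i).-1 < m + n)%N.
  have : (\sum_i d i = \sum_i (d i).-1 + n)%N.
    rewrite -[X in (_ + X)%N](card_ord n) -sum1_card -big_split /=.
    by apply: eq_bigr => i _; rewrite addn1 prednK.
  move: dm; lia.
have : idl (map fst l) p.
  apply: (@reg_topdeg _ _ _ m); rewrite ?fstl.
  - by move=> _ /mapP[i _ ->]; apply: sK_homog.
  - apply: reg_trade reg_gK => [j|j|||l' i0 hl]; last exact: xideriv_nilpotent.
    + by exists (d j); [apply: d_gt0|apply: gK_homog].
    + by exists (d j).-1; [rewrite -subn1 subn_gt0|apply: sK_homog].
    + by rewrite rev_uniq enum_uniq.
    + by move=> j; rewrite mem_rev mem_enum.
  - by rewrite size_map size_rev size_enum_ord.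
  - by rewrite big_map enum_rev_sum.
  - exact: pm.
by rewrite fstl.
Qed.

End GenericDirection.

(** * Operators with constant coefficients *)

Section DifferentialOperators.
Variables (n : nat) (A : comNzRingType).
Implicit Types p q h : {mpoly A[n]}.

(** The polynomial [p] is read as a symbol: its variables become partial derivatives, with
    coefficients on the left. *)
Definition diffop p h := \sum_(m <- msupp p) p@_m *: h^`M[m].

Lemma diffop_sub s p h : uniq s -> {subset msupp p <= s} ->
  diffop p h = \sum_(m <- s) p@_m *: h^`M[m].
Proof.
move=> us ps; rewrite [RHS](bigID (mem (msupp p))) /= [X in _ = _ + X]big1 ?addr0.
  rewrite -[RHS]big_filter; apply: perm_big; apply: uniq_perm.
  - exact: msupp_uniq.
  - by rewrite filter_uniq.
  - by move=> m; rewrite mem_filter; case: (boolP (m \in _)) => // /ps ->.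
by move=> m /memN_msupp_eq0->; rewrite scale0r.
Qed.

Lemma diffopD p q h : diffop (p + q) h = diffop p h + diffop q h.
Proof.
pose s := undup (msupp p ++ msupp q).
have us : uniq s by apply: undup_uniq.
have sub r : {subset r <= msupp p ++ msupp q} -> {subset r <= s}.
  by move=> rs m /rs; rewrite mem_undup.
rewrite !(diffop_sub h us); first last.
- by apply: sub; apply: msuppD_le.
- by apply: sub => m; rewrite mem_cat => ->.
- by apply: sub => m; rewrite mem_cat orbC => ->.
by rewrite -big_split; apply: eq_bigr => m _; rewrite mcoeffD scalerDl.
Qed.

Lemma diffop0 h : diffop 0 h = 0.
Proof. by rewrite /diffop msupp0 big_nil. Qed.

Lemma diffop_sum (I : Type) (r : seq I) (P : pred I) (F : I -> {mpoly A[n]}) h :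
  diffop (\sum_(i <- r | P i) F i) h = \sum_(i <- r | P i) diffop (F i) h.
Proof. by elim/big_rec2: _ => [|i x y _ <-]; [apply: diffop0|rewrite diffopD]. Qed.

Lemma diffopZX c m h : diffop (c *: 'X_[m]) h = c *: h^`M[m].
Proof.
rewrite (@diffop_sub [:: m]) ?big_seq1 ?mcoeffZ ?mcoeffX ?eqxx ?mulr1 //.
by move=> m' /msuppZ_le; rewrite msuppX.
Qed.

Lemma diffop_mulC p c h : diffop (p * c%:MP) h = c *: diffop p h.
Proof.
elim/mpolyind: p => [|a m p _ _ IH]; first by rewrite mul0r diffop0 scaler0.
rewrite mulrDl !diffopD IH scalerDr; congr (_ + _).
by rewrite mulrC mul_mpolyC scalerA !diffopZX scalerA.
Qed.

Lemma diffop_mulX p l h : diffop (p * 'X_l) h = (diffop p h)^`M(l).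
Proof.
elim/mpolyind: p => [|a m p _ _ IH]; first by rewrite mul0r diffop0 mderiv0.
rewrite mulrDl !diffopD IH mderivD; congr (_ + _).
by rewrite -scalerAl -mpolyXD !diffopZX mderivZ mderivmDm mderivmU1m.
Qed.

End DifferentialOperators.

Section Surjectivity.
Variables (n : nat) (k : fieldType) (A : comNzRingType) (f : {rmorphism k -> A}).
Hypothesis char0 : [pchar k] =i pred0.

(* A nonzero operator with constant coefficients is onto: modulo lower
   monomials, it maps X^(m + m0) to a multiple of X^m, where m0 is its least
   monomial. *)
Lemma diffop_onto (q : {mpoly k[n]}) (h : {mpoly A[n]}) :
  q != 0 -> exists h', diffop (map_mpoly f q) h' = h.
Proof.
move=> qn0; pose Q := map_mpoly f q.
have QD x y : diffop Q (x + y) = diffop Q x + diffop Q y.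
  rewrite /diffop -big_split; apply: eq_bigr => m _.
  by rewrite mderivmD scalerDr.
have Q0 : diffop Q 0 = 0.
  by rewrite /diffop big1 // => m _; rewrite raddf0 scaler0.
suff mono m c : exists h', diffop Q h' = c *: 'X_[m].
  elim/mpolyind: h => [|c m p _ _ [h2 <-]].
    by exists 0.
  by have [h1 <-] := mono m c; exists (h1 + h2).
move: c; elim/(@ltmwf n): m => m IH c.
pose a := mlast q; have qa : q@_a != 0 by rewrite -mcoeff_msupp mlast_supp.
pose fall b := (\prod_(i < n) ((m + a)%MM i) ^_ (b i))%N.
have falla : (fall a)%:R != 0 :> k.
  rewrite (proj1 (pcharf0P k) char0) -lt0n prodn_gt0 // => i.
  by rewrite ffact_gt0 mnmDE leq_addl.
pose c0 := f (q@_a * (fall a)%:R)^-1 * c.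
have QE : diffop Q (c0 *: 'X_[m + a])
    = c *: 'X_[m] + \sum_(b <- msupp q | b != a)
        (f (q@_b * (fall b)%:R) * c0) *: 'X_[m + a - b].
  have -> : diffop Q (c0 *: 'X_[m + a]) = \sum_(b <- msupp q)
        (f (q@_b * (fall b)%:R) * c0) *: 'X_[m + a - b].
    rewrite (@diffop_sub _ _ (msupp q)) ?msupp_uniq //; last first.
      move=> b; rewrite !mcoeff_msupp mcoeff_map_mpoly.
      by apply: contraNneq => ->; rewrite raddf0.
    apply: eq_bigr => b _; rewrite mcoeff_map_mpoly mderivmZ mderivmX !scalerA.
    by rewrite rmorphM rmorph_nat; congr (_ *: _); ring.
  rewrite (bigD1_seq a) ?mlast_supp ?msupp_uniq //=; congr (_ *: 'X_[_] + _).
    by rewrite /c0 mulrA -rmorphM mulfV ?rmorph1 ?mul1r // mulf_neq0.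
  by rewrite addmK.
(* For [b] other than the least monomial [a], the monomial [m + a - b] is smaller than [m], so
   induction applies. If [b] does not divide [m + a], the falling factorial [fall b] vanishes. *)
have [r rE] : exists r, diffop Q r = \sum_(b <- msupp q | b != a)
        (f (q@_b * (fall b)%:R) * c0) *: 'X_[m + a - b].
  rewrite big_seq_cond; elim/big_ind: _ => [|_ _ [x <-] [y <-]|b /andP[qb ba]].
  - by exists 0.
  - by exists (x + y).
  - have [bma|nbma] := boolP (b <= m + a)%MM.
      apply: IH; rewrite -(ltmc_add2l _ _ b) submK // ltmc_add2r.
      by rewrite lt_neqAle eq_sym ba mlast_lemc.
    exists 0; rewrite Q0 (_ : fall b = 0%N) ?mulr0 ?rmorph0 ?mul0r ?scale0r //.
    move: nbma; rewrite /lem negb_forall => /existsP[j].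
    rewrite -ltnNge => lti; apply/eqP; rewrite /fall (bigD1 j) //= muln_eq0.
    by rewrite ffact_small.
exists (c0 *: 'X_[m + a] - r).
have QN x : diffop Q (- x) = - diffop Q x.
  by apply/eqP; rewrite -addr_eq0 -QD addNr Q0.
by rewrite QD QN QE rE addrK.
Qed.

End Surjectivity.

(** * Images of the Hamiltonian operators of the [g i] *)

Section Hamiltonian.
Variables (n' : nat).
Local Notation n := n'.+1.
Variables (k : fieldType).
Hypothesis char0 : [pchar k] =i pred0.
Variables (g : 'I_n -> {mpoly k[n]}) (d : 'I_n -> nat).
Hypotheses (gd : forall i, g i \is (d i).-homog) (d_gt0 : forall i, (0 < d i)%N).
Local Notation e := (rev (enum 'I_n)).
Hypothesis reg_g : reg (map g e).
Hypothesis g_neq0 : forall i, g i != 0.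
Local Notation P := {mpoly k[n]}.
Local Notation phi := (map_mpoly (@mpolyC n k) : {mpoly k[n]} -> {mpoly P[n]}).

(** If all degrees exceed 1, denominators are cleared in [xideriv_top_gt1]. If some [g i] is linear,
    its derivative in direction xi is a nonzero linear form in xi free of y, and this form serves as
    [q]. *)
Lemma xideriv_conductor m f : (\sum_i d i < m + n.*2)%N -> f \is m.-homog ->
  exists2 q : P, q != 0 & idl (map (xideriv g) e) (q *: phi f).
Proof.
move=> dm fm; have [gt1|] := pselect (forall i, (1 < d i)%N).
  apply: idl_denominator; rewrite -map_comp.
  apply: (xideriv_top_gt1 char0 gd d_gt0 reg_g gt1 dm).
  by do 2!apply: dhomog_map_mpoly.
move=> /existsNP[i /negP]; rewrite -leqNgt => di1.
have {}di1 : d i = 1%N by apply/eqP; rewrite eqn_leq di1 d_gt0.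
have gi1 : g i \is 1.-homog by rewrite -di1.
pose q : P := \sum_l mcoeff 0%MM (g i)^`M(l) *: 'X_l.
have qE : xideriv g i = q%:MP.
  rewrite /xideriv raddf_sum; apply: eq_bigr => l _.
  have -> : (g i)^`M(l) = (mcoeff 0%MM (g i)^`M(l))%:MP.
    apply/mpolyP => t; rewrite mcoeffC; have [->|t0] := eqVneq t 0%MM.
      by rewrite mulr1.
    rewrite mulr0; apply: dhomog_nemf_coeff (dhomog_mderiv l gi1) _.
    by rewrite /= mdeg_eq0.
  rewrite map_mpolyC -[RHS]/(mpolyC n _) mcoeffC eqxx mulr1 -!mul_mpolyC mulrC.
  by rewrite mpolyCM.
exists q; last first.
  rewrite -mul_mpolyC -qE; apply/idlMr/idl_mem/map_f.
  by rewrite mem_rev mem_enum.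
apply: contraNneq (g_neq0 i) => q0; apply/eqP/mpolyP => t; rewrite mcoeff0.
have [t1|t1] := eqVneq (mdeg t) 1%N; last exact: dhomog_nemf_coeff gi1 t1.
have /mdeg1P[l /eqP->] : mdeg t == 1%N by apply/eqP.
have := congr1 (mcoeff U_(l)) q0; rewrite mcoeff0 raddf_sum /=.
rewrite (bigD1 l) //= big1 ?addr0; last first.
  by move=> j jl; rewrite mcoeffZ mcoeffXU (negPf jl) mulr0.
by rewrite mcoeffZ mcoeffXU eqxx mulr1 mcoeff_deriv add0m mnm0E mulr1n.
Qed.

Local Notation A := {mpoly k[n]}.

(* [{mpoly P[n]}] holds polynomials in y over k[xi], [{mpoly A[n]}] polynomials
   in xi (or in x) over k[y]. *)
Let swap : {rmorphism {mpoly P[n]} -> {mpoly A[n]}} :=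
  mmap (map_mpoly (@mpolyC n k)) (fun i => ('X_i)%:MP).

Let swapC c : swap c%:MP = phi c.
Proof. exact: mmapC. Qed.

Let swapX i : swap 'X_i = ('X_i)%:MP.
Proof. exact: etrans (mmapX _ _ _) (mmap1U _ _). Qed.

Let swap_phi f : swap (phi f) = f%:MP.
Proof.
apply: (@mpoly_rmorph_eq _ _ _ (swap \o map_mpoly (@mpolyC n k)) (@mpolyC n A)) => [c|i].
  apply: etrans (congr1 swap (map_mpolyC n (@mpolyC n k) c)) _.
  exact: etrans (swapC _) (map_mpolyC n (@mpolyC n k) c).
exact: etrans (congr1 swap (map_mpolyX (@mpolyC n k) _)) (swapX i).
Qed.

Let swap_xideriv i : swap (xideriv g i) = \sum_l 'X_l * (g i)^`M(l)%:MP.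
Proof.
rewrite /xideriv rmorph_sum; apply: eq_bigr => l _.
by rewrite -mul_mpolyC rmorphM swap_phi swapC map_mpolyX.
Qed.

(** Write [h] as q(d/dx) applied to some [h'], and apply the relation expressing q(xi) f by the
    derivatives of the [g i], with d/dx for xi, to [h']. Polynomials in y commute with d/dx, so
    [u i] is the image of [h'] under the i-th coefficient. *)
Theorem hamiltonian_image m f h : (\sum_i d i < m + n.*2)%N -> f \is m.-homog ->
  exists u : 'I_n -> {mpoly A[n]},
    f *: h = \sum_i \sum_l (g i)^`M(l) *: (u i)^`M(l).
Proof.
move=> dm fm; have [q qn0 /(idl_map swap)] := xideriv_conductor dm fm.
have [h' <-] := diffop_onto (@mpolyC n k) char0 h qn0.
rewrite -map_comp => /(idl_map_sum _)[|c]; first by rewrite rev_uniq enum_uniq.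
rewrite -mul_mpolyC rmorphM swap_phi swapC => /(congr1 (fun p => diffop p h')).
rewrite diffop_mulC => ->; exists (fun i => diffop (c i) h').
rewrite diffop_sum (perm_big (enum 'I_n)) ?perm_rev //= big_enum /=.
apply: eq_bigr => i _; rewrite [mmap _ _ _](swap_xideriv i) mulr_sumr diffop_sum.
by apply: eq_bigr => l _; rewrite mulrA diffop_mulC diffop_mulX.
Qed.

End Hamiltonian.

(** * Poisson brackets in Darboux coordinates *)

Lemma dhomog_mmap (R : comNzRingType) n N (L : 'I_n -> {mpoly R[N]}) b p :
  (forall i, L i \is 1.-homog) -> p \is b.-homog ->
  mmap (@mpolyC N R) L p \is b.-homog.
Proof.
move=> L1 pa; rewrite /mmap big_seq; apply: rpred_sum => m mp.
rewrite mul_mpolyC; apply: rpredZ.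
have <- : mdeg m = b by apply: (dhomogP _ _ _ pa).
rewrite mdegE /mmap1.
elim: (index_enum _) => [|i s IH]; first by rewrite !big_nil dhomog1.
rewrite !big_cons; apply: dhomogM IH.
by have := dhomogMn (m i) (L1 i); rewrite mul1n.
Qed.

Section Bracket.
Variables (N : nat) (k : fieldType) (M : 'M[k]_N).
Local Notation R := {mpoly k[N]}.
Implicit Types f h p q : R.

(** The biderivation with constant matrix [M]; [poisson] is the case of the transposed inverse of
    the Gram matrix. *)
Definition bracket f h : R := \sum_i \sum_j M i j *: (f^`M(i) * h^`M(j)).

Lemma bracketDl f1 f2 h : bracket (f1 + f2) h = bracket f1 h + bracket f2 h.
Proof.
rewrite /bracket -big_split; apply: eq_bigr => i _; rewrite -big_split.
by apply: eq_bigr => j _; rewrite /= mderivD mulrDl scalerDr.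
Qed.

Lemma bracketDr f h1 h2 : bracket f (h1 + h2) = bracket f h1 + bracket f h2.
Proof.
rewrite /bracket -big_split; apply: eq_bigr => i _; rewrite -big_split.
by apply: eq_bigr => j _; rewrite /= mderivD mulrDr scalerDr.
Qed.

Lemma bracketMl f1 f2 h :
  bracket (f1 * f2) h = bracket f1 h * f2 + f1 * bracket f2 h.
Proof.
rewrite /bracket mulr_suml mulr_sumr -big_split; apply: eq_bigr => i _.
rewrite mulr_suml mulr_sumr -big_split; apply: eq_bigr => j _ /=.
rewrite mderivM -scalerAl -scalerAr -scalerDr; congr (_ *: _).
by rewrite mulrDl mulrAC mulrA.
Qed.

Lemma bracketMr f h1 h2 :
  bracket f (h1 * h2) = bracket f h1 * h2 + h1 * bracket f h2.
Proof.
rewrite /bracket mulr_suml mulr_sumr -big_split; apply: eq_bigr => i _.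
rewrite mulr_suml mulr_sumr -big_split; apply: eq_bigr => j _ /=.
rewrite mderivM -scalerAl -scalerAr -scalerDr; congr (_ *: _).
by rewrite mulrDr mulrA mulrCA.
Qed.

Lemma bracketCl c h : bracket c%:MP h = 0.
Proof.
rewrite /bracket big1 // => i _; rewrite big1 // => j _.
by rewrite mderivC mul0r scaler0.
Qed.

Lemma bracketCr f c : bracket f c%:MP = 0.
Proof.
rewrite /bracket big1 // => i _; rewrite big1 // => j _.
by rewrite mderivC mulr0 scaler0.
Qed.

Section DarbouxPair.
Variables (n : nat) (al be : 'I_n -> R).
Hypotheses (al_al : forall i j, bracket (al i) (al j) = 0)
  (al_be : forall i j, bracket (al i) (be j) = (i == j)%:R).
Local Notation A := {mpoly k[n]}.

Variables (subst_al : {rmorphism A -> R})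
  (subst_al_be : {rmorphism {mpoly A[n]} -> R}).
Hypotheses (subst_alC : forall c, subst_al c%:MP = c%:MP)
  (subst_alX : forall i, subst_al 'X_i = al i)
  (subst_al_beC : forall c, subst_al_be c%:MP = subst_al c)
  (subst_al_beX : forall i, subst_al_be 'X_i = be i).

Lemma bracket_al_al g c : bracket (subst_al g) (subst_al c) = 0.
Proof.
elim/mpoly_alg_ind: c => [c|j|p q Ep Eq|p q Ep Eq]; first last.
- by rewrite rmorphM bracketMr Ep Eq mul0r mulr0 addr0.
- by rewrite rmorphD bracketDr Ep Eq addr0.
- rewrite subst_alX; elim/mpoly_alg_ind: g => [c|i|p q Ep Eq|p q Ep Eq].
  + by rewrite subst_alC bracketCl.
  + by rewrite subst_alX al_al.
  + by rewrite rmorphD bracketDl Ep Eq addr0.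
  + by rewrite rmorphM bracketMl Ep Eq mul0r mulr0 addr0.
- by rewrite subst_alC bracketCr.
Qed.

Lemma bracket_al_be g j : bracket (subst_al g) (be j) = subst_al g^`M(j).
Proof.
elim/mpoly_alg_ind: g => [c|i|p q Ep Eq|p q Ep Eq].
- by rewrite subst_alC bracketCl mderivC rmorph0.
- by rewrite subst_alX al_be mderivXU rmorph_nat.
- by rewrite rmorphD bracketDl Ep Eq mderivD rmorphD.
- by rewrite rmorphM bracketMl Ep Eq mderivM rmorphD !rmorphM.
Qed.

(** Both sides are derivations in [h] that vanish on polynomials in the [al i], so they are compared
    on the variables. *)
Lemma bracket_subst (g : A) (h : {mpoly A[n]}) : bracket (subst_al g) (subst_al_be h)
  = subst_al_be (\sum_l g^`M(l) *: h^`M(l)).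
Proof.
have ZE (c : A) (p : {mpoly A[n]}) : subst_al_be (c *: p) = subst_al c * subst_al_be p.
  by rewrite -mul_mpolyC rmorphM subst_al_beC.
rewrite raddf_sum (eq_bigr _ (fun l _ => ZE _ _)).
elim/mpoly_alg_ind: h => [c|j|p q Ep Eq|p q Ep Eq].
- rewrite subst_al_beC bracket_al_al big1 // => l _.
  by rewrite mderivC rmorph0 mulr0.
- rewrite subst_al_beX bracket_al_be (bigD1 j) //= big1 ?addr0.
    by rewrite mderivX mnm1E eqxx scale1r -[X in (X - _)%MM]add0m addmK mpolyX0 rmorph1 mulr1.
  by move=> l lj; rewrite mderivX mnm1E eq_sym (negPf lj) scale0r rmorph0 mulr0.
- have -> : subst_al_be (p + q) = subst_al_be p + subst_al_be q by apply: rmorphD.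
  rewrite bracketDr Ep Eq -big_split; apply: eq_bigr => l _.
  by rewrite mderivD [X in _ = _ * X](rmorphD subst_al_be) mulrDr.
- have -> : subst_al_be (p * q) = subst_al_be p * subst_al_be q by apply: rmorphM.
  rewrite bracketMr Ep Eq mulr_suml mulr_sumr -big_split; apply: eq_bigr => l _.
  rewrite mderivM [X in _ = _ * X](rmorphD subst_al_be).
  rewrite !(rmorphM subst_al_be) mulrDr; congr (_ + _); last exact: mulrCA.
  by rewrite -mulrA.
Qed.

Lemma subst_al_be_onto (F : R) :
  (forall i, exists u v : 'I_n -> k, 'X_i = \sum_j (u j *: al j + v j *: be j)) ->
  exists h : {mpoly A[n]}, subst_al_be h = F.
Proof.
move=> span; elim/mpoly_alg_ind: F => [c|i|_ _ [p <-] [q <-]|_ _ [p <-] [q <-]].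
- by exists c%:MP%:MP; rewrite subst_al_beC subst_alC.
- have [u [v ->]] := span i.
  exists (\sum_j ((u j)%:MP * 'X_j)%:MP + \sum_j (v j)%:MP%:MP * 'X_j).
  rewrite rmorphD !rmorph_sum -big_split; apply: eq_bigr => j _.
  apply/esym; congr (_ + _).
    by rewrite subst_al_beC rmorphM subst_alC subst_alX mul_mpolyC.
  by rewrite (rmorphM subst_al_be) subst_al_beC subst_alC subst_al_beX mul_mpolyC.
- by exists (p + q); rewrite rmorphD.
- by exists (p * q); rewrite rmorphM.
Qed.

End DarbouxPair.
End Bracket.

(** This is [hamiltonian_image] in Darboux coordinates, with [al] in the role of y and [be] in that
    of x. *)
Lemma hamiltonian_ideal (k : fieldType) N (M : 'M[k]_N) n (al be : 'I_n -> {mpoly k[N]})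
  (g : 'I_n -> {mpoly k[n]}) (d : 'I_n -> nat) m f F :
  (0 < n)%N -> [pchar k] =i pred0 ->
  (forall i j, bracket M (al i) (al j) = 0) ->
  (forall i j, bracket M (al i) (be j) = (i == j)%:R) ->
  (forall i, exists u v : 'I_n -> k, 'X_i = \sum_j (u j *: al j + v j *: be j)) ->
  (forall i, g i \is (d i).-homog) -> (forall i, (0 < d i)%N) ->
  reg (map g (rev (enum 'I_n))) -> (forall i, g i != 0) ->
  (\sum_i d i < m + n.*2)%N -> f \is m.-homog ->
  exists u : 'I_n -> {mpoly k[N]},
    mmap (@mpolyC N k) al f * F
    = \sum_i bracket M (mmap (@mpolyC N k) al (g i)) (u i).
Proof.
case: n al be g d f => // n al be g d f _ char0 al_al al_be span gd d0 rg gn0 dm fm.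
pose S : {rmorphism {mpoly k[n.+1]} -> {mpoly k[N]}} := mmap (@mpolyC N k) al.
pose T : {rmorphism {mpoly {mpoly k[n.+1]}[n.+1]} -> {mpoly k[N]}} := mmap S be.
have SC c : S c%:MP = c%:MP by apply: mmapC.
have SX i : S 'X_i = al i by apply: etrans (mmapX _ _ _) (mmap1U _ _).
have TC c : T c%:MP = S c by apply: mmapC.
have TX i : T 'X_i = be i by apply: etrans (mmapX _ _ _) (mmap1U _ _).
suff : exists u : 'I_n.+1 -> {mpoly k[N]},
  S f * F = \sum_i bracket M (S (g i)) (u i) by [].
move: S T SC SX TC TX => S T SC SX TC TX.
have [h <-] := subst_al_be_onto SC SX TC TX F span.
have [u uE] := hamiltonian_image char0 gd d0 rg gn0 h dm fm.
exists (fun i => T (u i)).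
rewrite -TC -rmorphM mul_mpolyC uE rmorph_sum.
by apply: eq_bigr => i _; rewrite (bracket_subst al_al al_be SC SX TC TX).
Qed.

(** * Regular sequences *)

Section RegularSequence.
Variables (A : comNzRingType) (n : nat) (g : 'I_n -> A).

Lemma in_ideal_idl (i : nat) x :
  in_ideal g (fun j => (j < i)%N) x <-> idl (map g (rev (take i (enum 'I_n)))) x.
Proof.
have us : uniq (rev (take i (enum 'I_n))) by rewrite rev_uniq take_uniq ?enum_uniq.
have sumE (c : 'I_n -> A) : \sum_(j < n | (j < i)%N) c j * g j
    = \sum_(j <- rev (take i (enum 'I_n))) c j * g j.
  rewrite [RHS]big_uniq //=; apply: eq_bigl => j.
  by rewrite mem_rev in_take ?mem_enum // index_enum_ord.
split=> [[c ->]|/(idl_map_sum us)[c ->]]; last by exists c; rewrite sumE.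
by rewrite sumE; apply: sum_idl_map.
Qed.

Lemma regular_sequence_reg : regular_sequence g -> reg (map g (rev (enum 'I_n))).
Proof.
move=> [reg_g _].
suff : forall i, reg (map g (rev (take i (enum 'I_n)))).
  by move=> /(_ n); rewrite take_oversize // size_enum_ord.
elim=> [|i IH]; first by rewrite take0.
have [ni|i_ge] := ltnP i n; last first.
  by move: IH; rewrite !take_oversize ?size_enum_ord // ltnW.
rewrite (take_nth (Ordinal ni)) ?size_enum_ord // rev_rcons /=; split=> // a.
have -> : nth (Ordinal ni) (enum 'I_n) i = Ordinal ni.
  by apply: val_inj; rewrite /= nth_enum_ord.
by move=> /in_ideal_idl/(reg_g (Ordinal ni))/in_ideal_idl.
Qed.

(** A zero entry would put 1 in the ideal of the preceding ones, against properness. *)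
Lemma regular_sequence_neq0 i : regular_sequence g -> g i != 0.
Proof.
move=> [reg_g n1]; apply/eqP => gi0; apply: n1.
have [|c ->] := reg_g i 1.
  by exists (fun=> 0); rewrite gi0 mulr0 big1 // => j _; rewrite mul0r.
exists (fun j : 'I_n => if (j < i)%N then c j else 0).
rewrite big_mkcond; apply: eq_bigr => j _.
by case: ifP => // _; rewrite mul0r.
Qed.

End RegularSequence.

Lemma regular_sequence_iso (A B : comNzRingType) n (g : 'I_n -> A)
  (f : {rmorphism A -> B}) (f' : {rmorphism B -> A}) :
  cancel f f' -> cancel f' f -> regular_sequence g -> regular_sequence (f \o g).
Proof.
move=> fK f'K [reg_g n1]; split=> [i a [c aE]|[c oneE]].
  have [|e eE] := reg_g i (f' a).
    exists (f' \o c); rewrite -[g i]fK -rmorphM [X in f' X]aE rmorph_sum.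
    by apply: eq_bigr => j _; rewrite rmorphM /= fK.
  exists (f \o e); rewrite -[a]f'K eE rmorph_sum.
  by apply: eq_bigr => j _; rewrite rmorphM.
apply: n1; exists (f' \o c); rewrite -(rmorph1 f') oneE rmorph_sum.
by apply: eq_bigr => j _; rewrite rmorphM /= fK.
Qed.

(** * Linear forms on a symplectic space *)

Section LinearForms.
Variables (C : fieldType) (V : vectType C) (w : {skew_symmetric V}).
Hypothesis nondeg : nondegenerate w.
Local Notation N := (\dim {:V}).
Local Notation e := (vbasis {:V}).

Let wsumr (I : Type) (r : seq I) (P : pred I) v (F : I -> V) :
  w v (\sum_(i <- r | P i) F i) = \sum_(i <- r | P i) w v (F i).
Proof. exact: linear_sumr. Qed.

Let wsuml (I : Type) (r : seq I) (P : pred I) v (F : I -> V) :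
  w (\sum_(i <- r | P i) F i) v = \sum_(i <- r | P i) w (F i) v.
Proof. exact: linear_sumlz. Qed.

Let wZr v c u : w v (c *: u) = c * w v u. Proof. exact: linearZr. Qed.
Let wZl v c u : w (c *: u) v = c * w u v. Proof. exact: linearZl_LR. Qed.

Lemma skewC u v : w u v = - w v u.
Proof. by rewrite hermC /= expr1 mulN1r. Qed.

Let vE v : v = \sum_i coord e i v *: e`_i.
Proof. by apply: coord_vbasis; apply: memvf. Qed.

Let rowv v : 'rV[C]_N := \row_i coord e i v.

Let row_gram v i : (rowv v *m gram w) 0 i = w v e`_i.
Proof.
rewrite mxE [in RHS](vE v) wsuml; apply: eq_bigr => j _.
by rewrite !mxE wZl.
Qed.

Lemma nondeg_eq0 v : (forall u, w v u = 0) -> v = 0.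
Proof.
move=> v0; apply/eqP; rewrite -memv0 -(eqP nondeg).
by apply/mem_orthovP => u _.
Qed.

Lemma gram_unit : gram w \in unitmx.
Proof.
rewrite -row_free_unit -kermx_eq0; apply/rowV0P => r /sub_kermxP r0.
pose v := \sum_i r 0 i *: e`_i.
have free_e : free e by have := basis_free (vbasisP {:V}).
have vr : rowv v = r by apply/rowP => i; rewrite mxE coord_sum_free.
have v0 : v = 0.
  apply: nondeg_eq0 => u; rewrite (vE u) wsumr big1 // => i _.
  by rewrite wZr -row_gram vr r0 mxE mulr0.
by rewrite -vr v0; apply/rowP => i; rewrite !mxE linear0.
Qed.

Lemma form_represents (l : V -> C) : linear_for *%R l -> exists a, forall v, w a v = l v.
Proof.
move=> linl; have l0 : l 0 = 0.
  have := linl (-1) 0 0; rewrite scaler0 addr0 mulN1r => l0.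
  by rewrite [LHS]l0 addNr.
have lE (c : 'I_N -> C) : l (\sum_i c i *: e`_i) = \sum_i c i * l e`_i.
  by elim/big_rec2: _ => // i x y _ <-; apply: linl.
pose r := \row_i l e`_i *m invmx (gram w).
pose a := \sum_i r 0 i *: e`_i; exists a => v.
have free_e : free e by have := basis_free (vbasisP {:V}).
have ar : rowv a = r by apply/rowP => i; rewrite mxE coord_sum_free.
rewrite (vE v) wsumr lE; apply: eq_bigr => i _.
by rewrite wZr -row_gram ar mulmxKV ?gram_unit // mxE.
Qed.

Definition linform a : polyfun V := \sum_(i < N) w a e`_i *: 'X_i.

Lemma eval_linform a v : pf_eval (linform a) v = w a v.
Proof.
rewrite /pf_eval /linform raddf_sum [in RHS](vE v) wsumr; apply: eq_bigr => i _.
by rewrite /= mevalZ mevalXU wZr mulrC.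
Qed.

Lemma linformD a b : linform (a + b) = linform a + linform b.
Proof.
rewrite /linform -big_split; apply: eq_bigr => i _ /=.
by rewrite linearDl scalerDl.
Qed.

Lemma linformZ c a : linform (c *: a) = c *: linform a.
Proof.
by rewrite /linform scaler_sumr; apply: eq_bigr => i _; rewrite wZl scalerA.
Qed.

Lemma linform_sum (I : Type) (r : seq I) (P : pred I) (F : I -> V) :
  linform (\sum_(i <- r | P i) F i) = \sum_(i <- r | P i) linform (F i).
Proof.
apply: (big_morph linform linformD).
by rewrite /linform big1 // => i _; rewrite linear0l scale0r.
Qed.

Lemma mderiv_linform a i : mderiv i (linform a : {mpoly C[N]}) = (w a e`_i)%:MP.
Proof.
rewrite /linform raddf_sum (bigD1 i) //= big1 ?addr0 => [|j ji].
  by rewrite mderivZ mderivXU eqxx -mul_mpolyC mulr1.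
by rewrite mderivZ mderivXU (negPf ji) scaler0.
Qed.

Lemma poisson_linform a b : poisson w (linform a) (linform b) = (w a b)%:MP.
Proof.
pose A := rowv a *m gram w; pose B := rowv b *m gram w.
have AE i : A 0 i = w a e`_i by rewrite row_gram.
have BE i : B 0 i = w b e`_i by rewrite row_gram.
(* The transposed inverse cancels against the transposed Gram factor of [B], leaving the Gram matrix
   between the coordinates of [a] and [b]. *)
have -> : w a b = (A *m (invmx (gram w))^T *m B^T) 0 0.
  rewrite /B trmx_mul -mulmxA [_^T *m (_ *m _)]mulmxA -trmx_mul mulmxV ?gram_unit //.
  rewrite trmx1 mul1mx mxE [in LHS](vE b) wsumr; apply: eq_bigr => i _.
  by rewrite wZr -AE mulrC [rowv b]lock !mxE -lock mxE.
transitivity ((\sum_i \sum_j (invmx (gram w))^T i j * (w a e`_i * w b e`_j))%:MP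
    : {mpoly C[N]}).
  have sumC (F : 'I_N -> C) : (\sum_i F i)%:MP = \sum_i (F i)%:MP :> {mpoly C[N]}.
    exact: raddf_sum.
  rewrite sumC; apply: eq_bigr => i _; rewrite sumC; apply: eq_bigr => j _.
  by rewrite !mderiv_linform -mpolyCM -mul_mpolyC -mpolyCM.
congr (_%:MP); rewrite mxE exchange_big; apply: eq_bigr => j _.
rewrite mxE mulr_suml; apply: eq_bigr => i _.
by rewrite [B^T _ _]mxE AE BE; ring.
Qed.

Section Darboux.
Variables (n : nat) (a b : 'I_n -> V).
Hypotheses (aa : forall i j, w (a i) (a j) = 0) (bb : forall i j, w (b i) (b j) = 0)
  (ab : forall i j, w (a i) (b j) = (i == j)%:R) (dimV : N = (2 * n)%N).

(** Pairing with the [b j] and the [a j] reads off coefficients, so the 2n vectors are independent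
    and hence form a basis. *)
Lemma darboux_span (c : V) :
  exists u v : 'I_n -> C, c = \sum_j (u j *: a j + v j *: b j).
Proof.
pose s (i : 'I_(n + n)) := match split i with inl j => a j | inr j => b j end.
pose X := [tuple s i | i < n + n].
have sumX (k : 'I_(n + n) -> C) : \sum_i k i *: X`_i
    = \sum_j (k (lshift n j) *: a j + k (rshift n j) *: b j).
  rewrite (eq_bigr (fun i => k i *: s i)) => [|i _]; last first.
    by rewrite -tnth_nth tnth_mktuple.
  rewrite big_split_ord /= -big_split; apply: eq_bigr => j _ /=.
  by rewrite /s -[lshift n j]/(unsplit (inl j)) -[rshift n j]/(unsplit (inr j)) !unsplitK.
have freeX : free X.
  apply/freeP => k; rewrite sumX => k0.
  have ka j : k (lshift n j) = 0.
    have := congr1 (fun u => w u (b j)) k0; rewrite linear0l wsuml (bigD1 j) //=.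
    rewrite big1 ?addr0 => [|i ij]; rewrite linearDl /= !wZl bb mulr0 addr0 ab.
      by rewrite eqxx mulr1.
    by rewrite (negPf ij) mulr0.
  have kb j : k (rshift n j) = 0.
    have := congr1 (w (a j)) k0; rewrite linear0r wsumr (bigD1 j) //=.
    rewrite big1 ?addr0 => [|i ij]; rewrite linearDr /= !wZr aa mulr0 add0r ab.
      by rewrite eqxx mulr1.
    by rewrite eq_sym (negPf ij) mulr0.
  by move=> i; rewrite -(splitK i); case: (split i) => j /=; [apply: ka|apply: kb].
have spanX : <<X>>%VS = fullv.
  apply/eqP; rewrite eqEdim subvf /= (eqnP freeX) size_tuple dimV.
  by rewrite mul2n addnn.
have cX : c \in <<X>>%VS by rewrite spanX memvf.
exists (fun j => coord X (lshift n j) c), (fun j => coord X (rshift n j) c).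
by rewrite {1}(coord_span cX) sumX.
Qed.
End Darboux.
End LinearForms.

Lemma mem_lspan (K : nzRingType) (E : lmodType K) (S : set E) x : S x -> x \in lspan S.
Proof.
move=> Sx; apply/asboolP; exists [:: (1, x)]; last by rewrite big_seq1 scale1r.
by move=> p; rewrite inE => /eqP->.
Qed.

(** * Polynomials of large degree are sums of brackets *)

Section Darboux.
Variables (C : fieldType) (V : vectType C) (w : {skew_symmetric V}).
Hypotheses (char0 : [pchar C] =i pred0) (nondeg : nondegenerate w).
Local Notation N := (\dim {:V}).
Variables (n : nat) (d : 'I_n -> nat).
Hypotheses (n_gt0 : (0 < n)%N) (dimV : N = (2 * n)%N).
Hypothesis d_gt0 : forall i, (0 < d i)%N.
Variable inv : set (polyfun V).
Local Notation T := (lspan (fun F : polyfun V => exists f h, inv f /\ F = poisson w f h)).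
Local Notation lsubst a := (mmap (@mpolyC N C) (fun j => linform w (a j) : {mpoly C[N]})).

Section OneSide.
Variables (a b : 'I_n -> V) (g : 'I_n -> {mpoly C[n]}).
Hypotheses (aa : forall i j, w (a i) (a j) = 0) (bb : forall i j, w (b i) (b j) = 0)
  (ab : forall i j, w (a i) (b j) = (i == j)%:R).
Hypotheses (gd : forall i, g i \is (d i).-homog) (reg_g : regular_sequence g)
  (inv_g : forall i, inv (lsubst a (g i))).

Lemma var_linform i : exists u v : 'I_n -> C,
  'X_i = \sum_j (u j *: linform w (a j) + v j *: linform w (b j)) :> {mpoly C[N]}.
Proof.
have [c cE] : exists c, forall v, w c v = coord (vbasis {:V}) i v.
  by apply: form_represents => // x u v; rewrite linearD linearZ.
have [u [v cuv]] := darboux_span aa bb ab dimV c; exists u, v.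
transitivity (linform w c : {mpoly C[N]}).
  rewrite /linform (bigD1 i) //= big1 ?addr0 => [|j ji]; rewrite cE.
    by rewrite (coord_free _ _ (basis_free (vbasisP _))) eqxx scale1r.
  by rewrite (coord_free _ _ (basis_free (vbasisP _))) (negPf ji) scale0r.
by rewrite {1}cuv linform_sum; apply: eq_bigr => j _; rewrite linformD !linformZ.
Qed.

Lemma darboux_ideal m f F : (\sum_i d i < m + n.*2)%N -> f \is m.-homog ->
  (lsubst a f * F : polyfun V) \in T.
Proof.
move=> dm fm; pose M := (invmx (gram w))^T.
have al_al i j : bracket M (linform w (a i)) (linform w (a j)) = 0.
  by rewrite [LHS](poisson_linform nondeg) aa.
have al_be i j : bracket M (linform w (a i)) (linform w (b j)) = (i == j)%:R.
  by rewrite [LHS](poisson_linform nondeg) ab mpolyC_nat.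
have gn0 i := regular_sequence_neq0 i reg_g.
have [u ->] := hamiltonian_ideal F n_gt0 char0 al_al al_be var_linform gd d_gt0
  (regular_sequence_reg reg_g) gn0 dm fm.
apply: rpred_sum => i _; apply: mem_lspan.
by exists (lsubst a (g i)), (u i).
Qed.
End OneSide.

Section TwoSides.
Variables (a b a' b' : 'I_n -> V) (g g' : 'I_n -> {mpoly C[n]}).
Hypotheses (aa : forall i j, w (a i) (a j) = 0) (bb : forall i j, w (b i) (b j) = 0)
  (ab : forall i j, w (a i) (b j) = (i == j)%:R).
Hypotheses (aa' : forall i j, w (a' i) (a' j) = 0)
  (bb' : forall i j, w (b' i) (b' j) = 0)
  (ab' : forall i j, w (a' i) (b' j) = (i == j)%:R).
Hypothesis ba' : forall i, exists c : 'I_n -> C, b i = \sum_j c j *: a' j.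
Hypotheses (gd : forall i, g i \is (d i).-homog) (reg_g : regular_sequence g)
  (inv_g : forall i, inv (lsubst a (g i))).
Hypotheses (gd' : forall i, g' i \is (d i).-homog) (reg_g' : regular_sequence g')
  (inv_g' : forall i, inv (lsubst a' (g' i))).

(** The bound forces [p] or [q] to have large degree. In the first case the invariants [g] in the
    forms of [a] apply; in the second, [q] is rewritten in the forms of [a'] and the invariants [g']
    apply. *)
Let base p q s t : p \is s.-homog -> q \is t.-homog ->
  (2 * \sum_i d i < s + t + 4 * n)%N ->
  (lsubst a p * lsubst b q : polyfun V) \in T.
Proof.
move=> ps qt st; have [sd|sd] := ltnP (\sum_i d i) (s + n.*2).
  exact: (darboux_ideal aa bb ab gd reg_g inv_g _ sd ps).
have td : (\sum_i d i < t + n.*2)%N by move: st sd; lia.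
have /choice[c cE] := ba'.
pose L j : {mpoly C[n]} := \sum_i c j i *: 'X_i.
have L1 j : L j \is 1.-homog.
  by apply: rpred_sum => i _; apply: rpredZ; rewrite dhomogX /= mdeg1.
have -> : lsubst b q = lsubst a' (mmap (@mpolyC n C) L q).
  pose F : {rmorphism {mpoly C[n]} -> {mpoly C[N]}} :=
    lsubst a' \o mmap (@mpolyC n C) L.
  apply: (@mpoly_rmorph_eq _ _ _ (lsubst b) F) => [x|i].
    by apply: etrans (mmapC _ _ _) _; rewrite /= !mmapC.
  apply: etrans (mmapX _ _ _) _; apply: etrans (mmap1U _ _) _.
  rewrite /= mmapX mmap1U {1}cE linform_sum [RHS]raddf_sum; apply: eq_bigr => j _.
  by rewrite /= mmapZ mmapX mmap1U linformZ mul_mpolyC.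
rewrite mulrC; apply: (darboux_ideal aa' bb' ab' gd' reg_g' inv_g' _ td).
exact: dhomog_mmap.
Qed.

(* A monomial in the coordinates (a, b) of large degree has large degree in
   one of the two sets of variables. *)
Let step m p q s t : p \is s.-homog -> q \is t.-homog ->
  (2 * \sum_i d i < s + t + mdeg m + 4 * n)%N ->
  (lsubst a p * lsubst b q * 'X_[m] : polyfun V) \in T.
Proof.
have [k] := ubnP (mdeg m); elim: k m p q s t => // k IH m p q s t mk ps qt st.
have [m0|mn0] := eqVneq m 0%MM.
  rewrite m0 mpolyX0 mulr1; apply: (base ps qt).
  by move: st; rewrite m0 mdeg0 addn0.
have [i mi] : exists i, m i != 0%N.
  apply/existsP; apply: contraNT mn0; rewrite negb_exists => /forallP mi0.
  by apply/eqP/mnmP => i; rewrite mnm0E; apply/eqP; rewrite -[_ == _]negbK.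
pose m' := (m - U_(i))%MM.
have mE : m = (m' + U_(i))%MM by rewrite submK // lep1mP.
have mdegE' : mdeg m = (mdeg m').+1 by rewrite mE mdegD mdeg1 addn1.
have m'k : (mdeg m' < k)%N by rewrite -ltnS -mdegE'.
have [u [v iE]] := var_linform aa bb ab i.
have X1 j : ('X_j : {mpoly C[n]}) \is 1.-homog by rewrite dhomogX /= mdeg1.
rewrite mE mpolyXD iE mulrA mulr_sumr; apply: rpred_sum => j _.
have SX c (x : 'I_n -> V) y : lsubst x (y * (c *: 'X_j)) = lsubst x y * (c *: linform w (x j)).
  rewrite (rmorphM (lsubst x)); congr (_ * _).
  by apply: etrans (mmapZ _ _ _ _) _; rewrite mmapX mmap1U mul_mpolyC.
rewrite mulrDr; apply: rpredD.
  have := IH m' (p * (u j *: 'X_j)) q (s + 1)%N t m'k.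
  rewrite SX => H; rewrite (_ : _ * _ = lsubst a p * (u j *: linform w (a j)) * lsubst b q * 'X_[m']).
    apply: H => //; last by move: st; rewrite mdegE'; lia.
    by apply: dhomogM => //; apply: rpredZ.
  by rewrite -!mulrA; congr (_ * _); rewrite mulrA mulrC.
have := IH m' p (q * (v j *: 'X_j)) s (t + 1)%N m'k.
rewrite SX => H; rewrite (_ : _ * _ = lsubst a p * (lsubst b q * (v j *: linform w (b j))) * 'X_[m']).
  apply: H => //; last by move: st; rewrite mdegE'; lia.
  by apply: dhomogM => //; apply: rpredZ.
by rewrite -!mulrA; congr (_ * (_ * _)); rewrite mulrC.
Qed.

Lemma darboux_top k (F : {mpoly C[N]}) : F \is k.-homog ->
  (2 * \sum_i d i < k + 4 * n)%N -> (F : polyfun V) \in T.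
Proof.
move=> Fk kd; rewrite [F]mpolyE big_seq; apply: rpred_sum => m mF.
have mk : mdeg m = k by apply: (dhomogP _ _ _ Fk).
have := @step m (F@_m)%:MP 1 0%N 0%N.
rewrite (rmorph1 (lsubst b)) mulr1 mmapC mul_mpolyC; apply.
- by rewrite -[_%:MP]mulr1 mul_mpolyC rpredZ // dhomog1.
- exact: dhomog1.
- by rewrite mk.
Qed.

End TwoSides.
End Darboux.

(** * Lagrangian decompositions *)

Section Lagrangian.
Variables (C : numClosedFieldType) (V : vectType C) (w : {skew_symmetric V}).
Variables X Y : {vspace V}.
Hypotheses (nondeg : nondegenerate w) (lagX : lagrangian w X) (lagY : lagrangian w Y).
Hypotheses (XY0 : (X :&: Y)%VS = 0%VS) (XYV : (X + Y)%VS = fullv).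

Let wZr v c u : w v (c *: u) = c * w v u. Proof. exact: linearZr. Qed.
Let wZl v c u : w (c *: u) v = c * w u v. Proof. exact: linearZl_LR. Qed.

Let YX0 : (Y :&: X)%VS = 0%VS. Proof. by rewrite capvC. Qed.

Let piX v : subvs_of X := vsproj X (daddv_pi X Y v).
Let piY v : subvs_of Y := vsproj Y (daddv_pi Y X v).

Let piX_lin c u v : piX (c *: u + v) = c *: piX u + piX v.
Proof. by rewrite /piX !linearP. Qed.

Let piY_lin c u v : piY (c *: u + v) = c *: piY u + piY v.
Proof. by rewrite /piY !linearP. Qed.

Let pi_add v : vsval (piX v) + vsval (piY v) = v.
Proof.
rewrite !vsprojK ?memv_pi //; apply: daddv_pi_add => //.
by rewrite XYV memvf.
Qed.

Let piX_y (y : subvs_of Y) : piX (vsval y) = 0.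
Proof.
have := daddv_pi_add XY0 (w := vsval y); rewrite XYV memvf => /(_ isT).
rewrite (daddv_pi_id YX0) ?subvsP // => /(canRL (addrK _)).
by rewrite subrr /piX => ->; rewrite linear0.
Qed.

Let piY_x (x : subvs_of X) : piY (vsval x) = 0.
Proof.
have := daddv_pi_add XY0 (w := vsval x); rewrite XYV memvf => /(_ isT).
rewrite (daddv_pi_id XY0) ?subvsP // => /(canRL (addKr _)).
by rewrite addNr /piY => ->; rewrite linear0.
Qed.

Let piX_x (x : subvs_of X) : piX (vsval x) = x.
Proof. by rewrite /piX (daddv_pi_id XY0) ?subvsP ?vsvalK. Qed.

Let piY_y (y : subvs_of Y) : piY (vsval y) = y.
Proof. by rewrite /piY (daddv_pi_id YX0) ?subvsP ?vsvalK. Qed.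

Let piX_add (x : subvs_of X) (y : subvs_of Y) : piX (vsval x + vsval y) = x.
Proof. by rewrite -[vsval x]scale1r piX_lin scale1r piX_x piX_y addr0. Qed.

Let piY_add (x : subvs_of X) (y : subvs_of Y) : piY (vsval x + vsval y) = y.
Proof. by rewrite -[vsval x]scale1r piY_lin scale1r piY_x piY_y add0r. Qed.

Let wXX (x x' : subvs_of X) : w (vsval x) (vsval x') = 0.
Proof.
have /mem_orthovP : vsval x \in orthov w X by rewrite [orthov w X]lagX subvsP.
by apply; apply: subvsP.
Qed.

Let wYY (y y' : subvs_of Y) : w (vsval y) (vsval y') = 0.
Proof.
have /mem_orthovP : vsval y \in orthov w Y by rewrite [orthov w Y]lagY subvsP.
by apply; apply: subvsP.
Qed.

Let annX a : (forall x : subvs_of X, w a (vsval x) = 0) -> exists x : subvs_of X, a = vsval x.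
Proof.
move=> h; have aX : a \in X.
  rewrite -[X]lagX; apply/mem_orthovP => u uX.
  by have := h (Subvs uX).
by exists (Subvs aX).
Qed.

Let annY a : (forall y : subvs_of Y, w a (vsval y) = 0) -> exists y : subvs_of Y, a = vsval y.
Proof.
move=> h; have aY : a \in Y.
  rewrite -[Y]lagY; apply/mem_orthovP => u uY.
  by have := h (Subvs uY).
by exists (Subvs aY).
Qed.

(** Since [linfun] agrees only with linear functions, the linearity of both nested maps has to be
    exhibited. *)
Lemma dualYE (y : subvs_of Y) (x : subvs_of X) :
  dualY w X Y y x = w (vsval x) (vsval y).
Proof.
have lin1 (z : subvs_of Y) : linear (fun x : subvs_of X => w (vsval x) (vsval z) : C^o).
  by move=> c u v; rewrite linearP linearDl /= wZl.
pose F z : {linear subvs_of X -> C^o} := HB.pack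
  (fun x : subvs_of X => w (vsval x) (vsval z) : C^o)
  (GRing.isLinear.Build C (subvs_of X) C^o _
    (fun x : subvs_of X => w (vsval x) (vsval z) : C^o) (lin1 z)).
pose D z : 'Hom(subvs_of X, C^o) := linfun (F z).
have linD : linear D.
  have DE z t : D z t = w (vsval t) (vsval z) by apply: etrans (lfunE (F z) t) _.
  move=> c u v; apply/lfunP => t; rewrite add_lfunE scale_lfunE !DE.
  by rewrite (linearP vsval) [LHS]linearDr; congr (_ + _); apply: wZr.
pose D' : {linear subvs_of Y -> 'Hom(subvs_of X, C^o)} := HB.pack D
  (GRing.isLinear.Build C (subvs_of Y) 'Hom(subvs_of X, C^o) _ D linD).
by apply: etrans (congr1 (fun f : 'Hom(subvs_of X, C^o) => f x) (lfunE D' y)) _; apply: etrans (lfunE (F y) x) _.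
Qed.

Lemma pairing_inj (y y' : subvs_of Y) :
  (forall x : subvs_of X, w (vsval x) (vsval y) = w (vsval x) (vsval y')) -> y = y'.
Proof.
move=> h; apply: val_inj; apply/eqP; rewrite -subr_eq0; apply/eqP.
apply: (nondeg_eq0 nondeg) => u; rewrite skewC -(pi_add u) linearDl /= !linearBr /=.
by rewrite h !wYY !subrr addr0 oppr0.
Qed.

(** Extended by zero on [Y], the form [l] is represented by a vector orthogonal to [Y], hence lying
    in the Lagrangian [Y]. The sign comes from skew-symmetry. *)
Lemma pairing_onto (l : subvs_of X -> C) : linear_for *%R l ->
  exists y : subvs_of Y, forall x, w (vsval x) (vsval y) = l x.
Proof.
move=> linl; have [|a aE] := form_represents nondeg (l := fun v => l (piX v)).
  by move=> c u v; rewrite piX_lin linl.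
have l0 : l 0 = 0.
  by have := linl (-1) 0 0; rewrite scaler0 addr0 mulN1r addNr.
have [y ay] : exists y : subvs_of Y, a = vsval y.
  by apply: annY => y; rewrite aE piX_y.
exists (- y) => x; have -> : vsval (- y) = - a by rewrite ay; apply: (linearN vsval).
by rewrite [LHS]linearNr -skewC aE piX_x.
Qed.

Lemma dimX_dimY : \dim {:subvs_of Y} = \dim {:subvs_of X}.
Proof.
have ker0 : lker (dualY w X Y) == 0%VS.
  apply/lker0P => y y' /lfunP yy'; apply: pairing_inj => x.
  by rewrite -!dualYE.
have full : limg (dualY w X Y) = fullv.
  apply/vspaceP => f; rewrite memvf; apply/esym.
  have [y yE] := pairing_onto (l := f) (fun c u v => linearP f c u v).
  suff -> : f = dualY w X Y y by rewrite memv_img ?memvf.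
  by apply/lfunP => x; rewrite dualYE yE.
rewrite -(limg_dim_eq (f := dualY w X Y) (U := fullv)); last by rewrite (eqP ker0) capv0.
by rewrite full !dimvf /dim /= muln1.
Qed.

Lemma dim_lagrangian : \dim {:V} = (2 * \dim {:subvs_of Y})%N.
Proof.
rewrite -XYV (dimv_disjoint_sum XY0) mul2n -addnn {1}dimX_dimY !dimvf.
by [].
Qed.

Lemma GL_actYE (A : 'End(subvs_of X)) (y : subvs_of Y) (x : subvs_of X) :
  w (vsval x) (vsval (GL_actY w A y)) = w (vsval ((A^-1)%VF x)) (vsval y).
Proof.
rewrite -!dualYE /GL_actY limg_lfunVK ?comp_lfunE //.
set f := (_ \o _)%VF; have [z zE] := pairing_onto (l := f) (fun c u v => linearP f c u v).
suff -> : f = dualY w X Y z by rewrite memv_img ?memvf.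
by apply/lfunP => t; rewrite dualYE zE.
Qed.

Lemma piX_act (A : 'End(subvs_of X)) v : piX (GL_actV w Y A v) = A (piX v).
Proof. exact: piX_add. Qed.

Lemma piY_act (A : 'End(subvs_of X)) v : piY (GL_actV w Y A v) = GL_actY w A (piY v).
Proof. exact: piY_add. Qed.


Variable G : seq 'End(subvs_of X).
Hypothesis groupG : finite_subgroup_GL G.
Local Notation m := (\dim {:subvs_of Y}).
Local Notation bX := (vbasis {:subvs_of X}).
Local Notation bY := (vbasis {:subvs_of Y}).

(* [G] may list an element several times, whence [undup]. *)
Definition herm (x' x : subvs_of X) : C :=
  \sum_(A <- undup G) \sum_j coord bX j (A x') * (coord bX j (A x))^*.

Lemma herm_linl x : linear_for *%R (herm^~ x).
Proof.
move=> c u v; rewrite /herm mulr_sumr -big_split; apply: eq_bigr => A _.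
rewrite mulr_sumr -big_split; apply: eq_bigr => j _ /=.
by rewrite (linearP A) (linearP (coord bX j)) mulrDl mulrA.
Qed.

Lemma herm_linr x' c u v : herm x' (c *: u + v) = c^* * herm x' u + herm x' v.
Proof.
rewrite /herm mulr_sumr -big_split; apply: eq_bigr => A _.
rewrite mulr_sumr -big_split; apply: eq_bigr => j _ /=.
by rewrite (linearP A) (linearP (coord bX j)) rmorphD rmorphM mulrDr mulrCA.
Qed.

(** All summands are nonnegative, and the one of the identity is the standard squared norm of the
    coordinates. *)
Lemma herm_eq0 x : herm x x = 0 -> x = 0.
Proof.
have [G1 _ _ _] := groupG; move=> h0.
have ge0 (A : 'End(subvs_of X)) :
    0 <= \sum_j coord bX j (A x) * (coord bX j (A x))^*.
  by apply: sumr_ge0 => j _; apply: mul_conjC_ge0.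
have le1 : \sum_j coord bX j (\1%VF x) * (coord bX j (\1%VF x))^* <= herm x x.
  rewrite /herm (bigD1_seq \1%VF) ?mem_undup ?undup_uniq //= lerDl.
  by apply: sumr_ge0 => A _; apply: ge0.
have : \sum_j coord bX j (\1%VF x) * (coord bX j (\1%VF x))^* = 0.
  by apply/eqP; rewrite eq_le ge0 andbT; rewrite h0 in le1.
move/eqP; rewrite psumr_eq0 => [/allP x0|j _]; last exact: mul_conjC_ge0.
rewrite (coord_vbasis (memvf x)) big1 // => j _.
have := x0 j (mem_index_enum j); rewrite id_lfunE mul_conjC_eq0 => /eqP->.
by rewrite scale0r.
Qed.

(** Right translation by the inverse of [A] permutes the elements of the group. *)
Lemma herm_act (A : 'End(subvs_of X)) x' x : A \in G ->
  herm x' (A x) = herm ((A^-1)%VF x') x.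
Proof.
have [_ Gker GV GM] := groupG; move=> GA.
have kerA : lker A == 0%VS by rewrite Gker.
have AK : (A \o A^-1 = \1)%VF by apply: lker0_compfV.
have VK : (A^-1 \o A = \1)%VF by apply: lker0_compVf.
pose f (B : 'End(subvs_of X)) := (B \o A^-1)%VF.
have perm_f : perm_eq (undup G) (map f (undup G)).
  apply: uniq_perm; rewrite ?undup_uniq //.
    rewrite map_inj_in_uniq ?undup_uniq // => B B' _ _ /(congr1 (fun D => D \o A)%VF).
    by rewrite /f -!comp_lfunA VK !comp_lfun1r.
  move=> B; rewrite mem_undup; apply/idP/mapP => [GB|[B']].
    exists (B \o A)%VF; first by rewrite mem_undup GM.
    by rewrite /f -comp_lfunA AK comp_lfun1r.
  by rewrite mem_undup => GB' ->; apply: GM => //; apply: GV.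
rewrite /herm (perm_big _ perm_f) big_map; apply: eq_bigr => B _.
apply: eq_bigr => j _; rewrite /f !comp_lfunE /=.
by rewrite (lker0_lfunK kerA).
Qed.

(* Composing the invariants on Y with kappa and conjugating yields polynomial
   invariants on X. *)
Lemma antilinear_iso : exists kappa : subvs_of X -> subvs_of Y,
  [/\ forall c u v, kappa (c *: u + v) = c^* *: kappa u + kappa v,
      forall x, kappa x = 0 -> x = 0
    & forall A x, A \in G -> kappa (A x) = GL_actY w A (kappa x)].
Proof.
have /choice[kappa kE] : forall x : subvs_of X, exists y : subvs_of Y,
    forall x' : subvs_of X, w (vsval x') (vsval y) = herm x' x.
  by move=> x; apply: pairing_onto; apply: herm_linl.
exists kappa; split.
- move=> c u v; apply: pairing_inj => x'.
  rewrite kE herm_linr -!kE (linearP vsval) [RHS]linearDr; congr (_ + _).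
  exact/esym/wZr.
- by move=> x kx0; apply: herm_eq0; rewrite -kE kx0 (linear0 vsval) linear0r.
- by move=> A x GA; apply: pairing_inj => x'; rewrite GL_actYE kE kE herm_act.
Qed.

(** A linear form on [V] vanishing on [X] is represented by a vector of [X], which is its own
    orthogonal. *)
Let frameX (l : 'I_m -> V -> C) : (forall j, linear_for *%R (l j)) ->
  (forall j (x : subvs_of X), l j (vsval x) = 0) ->
  exists x : 'I_m -> subvs_of X, forall j v, w (vsval (x j)) v = l j v.
Proof.
move=> linl l0.
suff /choice[x xE] : forall j, exists x : subvs_of X, forall v, w (vsval x) v = l j v.
  by exists x.
move=> j.
have [a aE] := form_represents nondeg (linl j).
have [x ax] : exists x : subvs_of X, a = vsval x by apply: annX => x; rewrite aE l0.
by exists x => v; rewrite -ax aE.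
Qed.

Let frameY (l : 'I_m -> V -> C) : (forall j, linear_for *%R (l j)) ->
  (forall j (y : subvs_of Y), l j (vsval y) = 0) ->
  exists y : 'I_m -> subvs_of Y, forall j v, w (vsval (y j)) v = l j v.
Proof.
move=> linl l0.
suff /choice[y yE] : forall j, exists y : subvs_of Y, forall v, w (vsval y) v = l j v.
  by exists y.
move=> j.
have [a aE] := form_represents nondeg (linl j).
have [y ay] : exists y : subvs_of Y, a = vsval y by apply: annY => y; rewrite aE l0.
by exists y => v; rewrite -ay aE.
Qed.

Let coord_bY (i j : 'I_m) : coord bY i bY`_j = (j == i)%:R.
Proof. exact: (coord_free _ _ (basis_free (vbasisP _))). Qed.

Lemma eval_linforms (a : 'I_m -> V) (p : {mpoly C[m]}) v :
  pf_eval (mmap (@mpolyC (\dim {:V}) C) (fun j => linform w (a j)) p : polyfun V) v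
    = p.@[fun j => w (a j) v].
Proof.
pose S : {rmorphism {mpoly C[m]} -> {mpoly C[\dim {:V}]}} :=
  mmap (@mpolyC (\dim {:V}) C) (fun j => linform w (a j) : {mpoly C[\dim {:V}]}).
pose ev : {rmorphism {mpoly C[\dim {:V}]} -> C} :=
  meval (fun i => coord (vbasis {:V}) i v).
pose ev' : {rmorphism {mpoly C[m]} -> C} := meval (fun j => w (a j) v).
apply: (@mpoly_rmorph_eq _ _ _ (ev \o S) ev') => [c|i].
  apply: etrans (congr1 ev (mmapC _ _ _)) _.
  exact: etrans (mevalC _ _) (esym (mevalC _ _)).
apply: etrans (congr1 ev (etrans (mmapX _ _ _) (mmap1U _ _))) _.
exact: etrans (eval_linform w (a i) v) (esym (mevalXU _ _)).
Qed.

Variables (g : 'I_m -> {mpoly C[m]}) (d : 'I_m -> nat).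
Hypotheses (gd : forall i, g i \is (d i).-homog) (d_gt0 : forall i, (0 < d i)%N).
Hypothesis reg_g : regular_sequence g.
Hypothesis inv_g : forall i, OY_inv w G (g i).
Hypothesis m_gt0 : (0 < m)%N.

(** Two Darboux frames are built. The forms of [a] are the coordinates on [Y], where the [g i] are
    invariant; those of [a'] are coordinates on [X] obtained from [kappa], where the conjugates of
    the [g i] are. *)
Theorem lspan_brackets_top k (F : {mpoly C[\dim {:V}]}) : F \is k.-homog ->
  (2 * \sum_i d i < k + 4 * m)%N -> (F : polyfun V) \in lspan (brackets w Y G).
Proof.
move=> Fk kd; have [kappa [klin k0 kact]] := antilinear_iso.
have [|j x|a aE] := @frameX (fun j v => coord bY j (piY v)).
- by move=> j c u v; rewrite piY_lin (linearP (coord bY j)).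
- by rewrite piY_x linear0.
have klinC j : linear_for *%R (fun x => (coord bY j (kappa x))^*).
  by move=> c u v; rewrite klin (linearP (coord bY j)) rmorphD rmorphM /= conjCK.
have kappa0 : kappa 0 = 0.
  by have := klin (-1) 0 0; rewrite scaler0 addr0 rmorphN1 scaleN1r addNr.
(* Conjugation turns the antilinear coordinates of [kappa] into linear forms. *)
have [||a' aE'] := @frameY (fun j v => (coord bY j (kappa (piX v)))^*).
- by move=> j c u v; rewrite piX_lin klinC.
- by move=> j y; rewrite piX_y kappa0 linear0 rmorph0.
(* The conjugated coordinates of [kappa] form an injective linear map between spaces of equal
   dimension, so [kappa] reaches the basis of [Y]. *)
have [b' bE'] : exists b' : 'I_m -> subvs_of X, forall j, kappa (b' j) = bY`_j.
  pose L x : 'rV[C]_m := \row_j (coord bY j (kappa x))^*.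
  have linL : linear L by move=> c u v; apply/rowP => j; rewrite !mxE klinC.
  pose L' : {linear subvs_of X -> 'rV[C]_m} := HB.pack L
    (GRing.isLinear.Build C (subvs_of X) 'rV[C]_m _ L linL).
  have ker0 : lker (linfun L') == 0%VS.
    rewrite -subv0; apply/subvP => x; rewrite memv_ker lfunE memv0 => /eqP Lx0.
    apply/eqP/k0; rewrite (coord_vbasis (memvf (kappa x))) big1 // => j _.
    move/rowP/(_ j): Lx0; rewrite !mxE => /eqP; rewrite conjC_eq0 => /eqP->.
    by rewrite scale0r.
  have full : limg (linfun L') = fullv.
    apply/eqP; rewrite eqEdim subvf limg_dim_eq ?(eqP ker0) ?capv0 //.
    by rewrite -dimX_dimY dimvf /dim /= mul1n.
  suff /choice[b' bE'] : forall j : 'I_m, exists x, kappa x = bY`_j by exists b'.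
  move=> i.
  have /memv_imgP[x _ xE] : (\row_j (j == i)%:R : 'rV[C]_m) \in limg (linfun L').
    by rewrite full memvf.
  exists x; rewrite (coord_vbasis (memvf (kappa x))) (bigD1 i) //=.
  have xj j : coord bY j (kappa x) = (j == i)%:R.
    apply: (can_inj conjCK); rewrite rmorph_nat.
    by move/rowP/(_ j): xE; rewrite lfunE !mxE => <-.
  rewrite xj eqxx scale1r big1 ?addr0 // => j ji.
  by rewrite xj (negPf ji) scale0r.
pose conjp : {rmorphism {mpoly C[m]} -> {mpoly C[m]}} := map_mpoly (@Num.conj C).
have conjpK : involutive conjp.
  by move=> p; apply/mpolyP => t; rewrite !mcoeff_map_mpoly /= conjCK.
have nat_sym (i j : 'I_m) : (i == j)%:R = (j == i)%:R :> C by rewrite eq_sym.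
have aa i j : w (vsval (a i)) (vsval (a j)) = 0 by apply: wXX.
have bb (i j : 'I_m) : w (vsval bY`_i) (vsval bY`_j) = 0 by apply: wYY.
have ab (i j : 'I_m) : w (vsval (a i)) (vsval bY`_j) = (i == j)%:R.
  by rewrite aE piY_y coord_bY nat_sym.
have aa' i j : w (vsval (a' i)) (vsval (a' j)) = 0 by apply: wYY.
have bb' i j : w (vsval (b' i)) (vsval (b' j)) = 0 by apply: wXX.
have ab' i j : w (vsval (a' i)) (vsval (b' j)) = (i == j)%:R.
  by rewrite aE' piX_x bE' coord_bY nat_sym rmorph_nat.
have ba' (i : 'I_m) : exists c : 'I_m -> C, vsval bY`_i = \sum_j c j *: vsval (a' j).
  have [u [v uv]] := darboux_span aa' bb' ab' dim_lagrangian (vsval bY`_i).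
  exists u; rewrite [LHS]uv big_split /= [X in _ + X]big1 ?addr0 // => j _.
  (* Pairing with [a' j] isolates [v j], and [Y] is isotropic. *)
  suff -> : v j = 0 by rewrite scale0r.
  have := wYY (a' j) bY`_i; rewrite uv [LHS]linear_sumr (bigD1 j) //= big1 => [|l lj].
    by rewrite addr0 linearDr /= !wZr aa' ab' eqxx mulr0 mulr1 add0r.
  by rewrite linearDr /= !wZr aa' ab' eq_sym (negPf lj) !mulr0 addr0.
have inv1 i : OV_inv w Y G (mmap (@mpolyC (\dim {:V}) C)
    (fun j => linform w (vsval (a j)) : {mpoly C[\dim {:V}]}) (g i)).
  move=> A GA v; rewrite !eval_linforms.
  have evE u : (g i).@[fun j => w (vsval (a j)) u] = pf_eval (g i : polyfun _) (piY u).
    by apply: meval_eq => j; rewrite aE.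
  by rewrite !evE piY_act; apply: inv_g.
have inv2 i : OV_inv w Y G (mmap (@mpolyC (\dim {:V}) C)
    (fun j => linform w (vsval (a' j)) : {mpoly C[\dim {:V}]}) (conjp (g i))).
  move=> A GA v; rewrite !eval_linforms.
  have conjE (p : {mpoly C[m]}) (x : 'I_m -> C) :
      (conjp p).@[fun j => (x j)^*] = (p.@[x])^*.
    pose F1 : {rmorphism {mpoly C[m]} -> C} := meval (fun j => (x j)^*) \o conjp.
    pose F2 : {rmorphism {mpoly C[m]} -> C} := Num.conj \o meval x.
    apply: (@mpoly_rmorph_eq _ _ _ F1 F2) => [c|j].
      by rewrite /F1 /F2 /= map_mpolyC !mevalC.
    by rewrite /F1 /F2 /= map_mpolyX !mevalXU.
  have evE u : (conjp (g i)).@[fun j => w (vsval (a' j)) u]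
      = (pf_eval (g i : polyfun _) (kappa (piX u)))^*.
    by rewrite -conjE; apply: meval_eq => j; rewrite aE'.
  by rewrite !evE piX_act kact // inv_g.
have gd' i : conjp (g i) \is (d i).-homog by apply: dhomog_map_mpoly.
have reg_g' : regular_sequence (conjp \o g) by apply: (regular_sequence_iso conjpK conjpK reg_g).
have char0 : [pchar C] =i pred0 by apply: pchar_num.
exact: (darboux_top char0 nondeg m_gt0 dim_lagrangian d_gt0 aa bb ab aa' bb' ab' ba'
  gd reg_g inv1 gd' reg_g' inv2 Fk kd).
Qed.

End Lagrangian.

(** * The bound on the top degree *)

Unset Implicit Arguments.
Local Close Scope quotient_scope.
Local Open Scope classical_set_scope.
Local Open Scope ring_scope.

Theorem corollary3p7 (R : realType) (n : nat) (V : vectType R[i])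
    (w : {skew_symmetric V}) (X Y : {vspace V})
    (G : seq 'End(subvs_of X))
    (g : 'I_n -> polyfun (subvs_of Y)) (d : 'I_n -> nat) :
  (0 < n)%N ->
  \dim {:V} = (2 * n)%N ->
  is_psymplectic w ->
  lagrangian w X -> lagrangian w Y ->
  (X :&: Y)%VS = 0%VS -> (X + Y)%VS = fullv ->
  finite_subgroup_GL G ->
  (forall i, OY_inv w G (g i)) ->
  (forall i, g i \is (d i).-homog) ->
  (forall i, (0 < d i)%N) ->
  regular_sequence g ->
  (topdeg R (HP0_comp w Y G)
     <= (2 * \sum_(i < n) ((d i)%:R - 2))%:E)%E.
Proof.
move=> n0 dimV [nondeg _ _] lagX lagY XY0 XYV grpG inv_g gd d0 reg_g.
have dimY : \dim {:subvs_of Y} = n.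
  have := dim_lagrangian nondeg lagY XY0 XYV; rewrite dimV => /eqP.
  by rewrite eqn_pmul2l // => /eqP.
subst n.
apply: ge_ereal_sup => _ [k [x [f fk <-]] f0 <-]; rewrite lee_fin.
(* The bound is stated without subtraction, as some [d i] may be 1. If it failed, [f] would be in
   the span of the brackets and its class would be zero. *)
have kd : (k + 4 * \dim {:subvs_of Y} <= 2 * \sum_i d i)%N.
  rewrite leqNgt; apply/negP => kd; apply: f0.
  have := lspan_brackets_top nondeg lagX lagY XY0 XYV grpG gd d0 reg_g inv_g n0 fk kd.
  by rewrite -[X in X \in _]subr0 Quotient.idealrBE => /eqP ->; rewrite raddf0.
rewrite sumrB -natr_sum sumr_const card_ord mulrBr -natrM lerBrDr.
apply: le_trans (_ : (2 * \sum_i d i)%:R <= _); last by [].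
apply: le_trans (_ : (k + 4 * \dim {:subvs_of Y})%:R <= _); last by rewrite ler_nat.
by rewrite natrD lerD2l -[X in 2 * X]mulr_natr -!natrM mulnA.
Qed.
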